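(* Fix a positive integer $n$, a nonzero $n$-partition $\lambda$ with $\lambda_n=0$, an $n$-semistandard tableau $T$ of shape $\lambda$, and $w\in S_n^\lambda$. Then $T\in\mathcal{D}_{\lambda,w}$ if and only if $\pi_T\le w$ in the Bruhat order, where $\pi_T$ is the final permutation of the greedy procedure described in the context.
   Context: Let $\lambda=(\lambda_1,\dots,\lambda_n)$ be weakly decreasing nonnegative integers with $\lambda_n=0$, $\lambda\neq0$, identified with its Young diagram. For $1\le j\le\lambda_1$ let $c_j$ be the length of column $j$; let $\zeta_1<\dots<\zeta_d$ be the distinct column lengths, $\zeta_0:=0$, $\zeta_{d+1}:=n$. Write $(j,i)$ for the box in column $j$, row $i$. Reading order: $(l,k)\le(j,i)$ iff $l<j$, or $l=j$ and $k\ge i$; convention $(j,c_j+1)$ means $(j-1,1)$. An $n$-semistandard tableau of shape $\lambda$ has entries in $[n]$, weakly increasing along rows and strictly increasing down columns; $T(j,i)$ denotes its entry, $C_j$ its $j$-th column, $\mathcal{T}_\lambda$ the set of such tableaux. A key is a tableau in which every value of $C_j$ appears in $C_{j-1}$ for $1<j\le\lambda_1$. Permutations are in one-line form. $S_n^\lambda$ is the set of $\phi\in S_n$ with $\phi_{\zeta_{h-1}+1}<\dots<\phi_{\zeta_h}$ for $1\le h\le d+1$. $Y_\lambda(\phi)$ is the key of shape $\lambda$ whose columns of length $\zeta_h$ contain $\phi_1,\dots,\phi_{\zeta_h}$ in increasing order ($1\le h\le d$). For $T\in\mathcal{T}_\lambda$, $R(T)$ denotes the right key of $T$ in the sense of Lascoux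 and Schützenberger. Define $\mathcal{D}_{\lambda,w}:=\{T\in\mathcal{T}_\lambda : R(T)\le Y_\lambda(w)\}$, where $\le$ compares tableaux of the same shape entrywise. Greedy procedure: $\pi^{(1,1)}$ has as first $c_1$ entries the entries of $C_1$ in increasing order, followed by the remaining elements of $[n]$ in increasing order. For locations $(j,i)$ with $j\ge2$, taken in reading order from $(2,c_2)$ to $(\lambda_1,1)$, define $\pi^{(j,i)}$ from $\pi:=\pi^{(j,i+1)}$: if $T(j-1,i)=T(j,i)$ set $\pi^{(j,i)}=\pi$; otherwise let $i_0=i$, and given $i_{x-1}$ with $\pi_{i_{x-1}}<T(j,i)$ let $i_x$ be the smallest index $>c_j$ with $\pi_{i_{x-1}}<\pi_{i_x}\le T(j,i)$, stopping at $i_m$ with $\pi_{i_m}=T(j,i)$; set $\pi^{(j,i)}_{i_x}=\pi_{i_{x-1}}$ ($1\le x\le m$), $\pi^{(j,i)}_{i_0}=\pi_{i_m}$, other entries unchanged. Then $\pi_T:=\pi^{(\lambda_1,1)}$. *)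

(* Defs.v *)
From mathcomp Require Import all_boot.
Set Implicit Arguments. Unset Strict Implicit. Unset Printing Implicit Defensive.

(*  - A partition lam = (lam_1,...,lam_n) is a seq nat of size n;          *)
(*    lam_i = nth 0 lam (i-1).                                             *)
(*  - A tableau T is the seq of its columns C_1 ... C_{lam_1}; each column *)
(*    lists its entries from top to bottom.  T(j,i) = entry in column j,   *)
(*    row i (1-indexed).                                                   *)
(*  - Permutations of [n] are in one-line form: seq nat, a rearrangement   *)
(*    of 1..n; phi_p = nth 0 phi (p-1).                                    *)

Definition is_partition (n : nat) (lam : seq nat) : Prop :=
  size lam = n /\ sorted geq lam.

Definition lam1 (lam : seq nat) : nat := nth 0 lam 0.

Definition collen (lam : seq nat) (j : nat) : nat := count (fun l => j <= l) lam.

Definition column (T : seq (seq nat)) (j : nat) : seq nat := nth [::] T j.-1.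

Definition entry (T : seq (seq nat)) (j i : nat) : nat := nth 0 (column T j) i.-1.

Definition has_shape (lam : seq nat) (T : seq (seq nat)) : Prop :=
  size T = lam1 lam /\
  forall j, 1 <= j <= lam1 lam -> size (column T j) = collen lam j.

Definition is_SSYT (n : nat) (lam : seq nat) (T : seq (seq nat)) : Prop :=
  has_shape lam T /\
  (forall j i, 1 <= j <= lam1 lam -> 1 <= i <= collen lam j ->
       1 <= entry T j i <= n) /\
  (forall j i, 1 <= j <= lam1 lam -> 1 <= i < collen lam j ->
       entry T j i < entry T j i.+1) /\
  (forall j i, 1 <= j < lam1 lam -> 1 <= i <= collen lam j.+1 ->
       entry T j i <= entry T j.+1 i).

Definition tab_le (lam : seq nat) (K Y : seq (seq nat)) : Prop :=
  forall j i, 1 <= j <= lam1 lam -> 1 <= i <= collen lam j ->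
    entry K j i <= entry Y j i.

Definition is_perm (n : nat) (phi : seq nat) : Prop := perm_eq phi (iota 1 n).

Definition pval (phi : seq nat) (p : nat) : nat := nth 0 phi p.-1.

Definition is_collen (lam : seq nat) (p : nat) : bool :=
  has (fun j => collen lam j == p) (iota 1 (lam1 lam)).

(* phi in S_n^lambda: phi increasing on each block
   zeta_{h-1}+1 .. zeta_h (zeta_0 = 0, zeta_{d+1} = n); i.e. phi_p < phi_{p+1}
   whenever p and p+1 lie in the same block, i.e. p is not some zeta_h. *)
Definition in_SnLam (n : nat) (lam : seq nat) (phi : seq nat) : Prop :=
  is_perm n phi /\
  forall p, 1 <= p < n -> ~~ is_collen lam p -> pval phi p < pval phi p.+1.

Definition Ykey (lam : seq nat) (phi : seq nat) : seq (seq nat) :=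
  [seq sort leq (take (collen lam j) phi) | j <- iota 1 (lam1 lam)].

Definition swap (u : seq nat) (a b : nat) : seq nat :=
  set_nth 0 (set_nth 0 u a (nth 0 u b)) b (nth 0 u a).

(* u < u t for a transposition t increasing the number of inversions:
   swap positions a < b with u_a < u_b *)
Definition bruhat_step (u v : seq nat) : Prop :=
  exists a b, a < b < size u /\ nth 0 u a < nth 0 u b /\ v = swap u a b.

Inductive bruhat_le : seq nat -> seq nat -> Prop :=
| bruhat_refl u : bruhat_le u u
| bruhat_trans u v w : bruhat_step u v -> bruhat_le v w -> bruhat_le u w.

Inductive knuth_elem : seq nat -> seq nat -> Prop :=
| knuth1 u v x y z : x <= y < z ->
    knuth_elem (u ++ [:: x; z; y] ++ v) (u ++ [:: z; x; y] ++ v)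
| knuth2 u v x y z : x < y <= z ->
    knuth_elem (u ++ [:: y; x; z] ++ v) (u ++ [:: y; z; x] ++ v).

Inductive knuth_eq : seq nat -> seq nat -> Prop :=
| knuth_refl u : knuth_eq u u
| knuth_step u v : knuth_elem u v -> knuth_eq u v
| knuth_sym u v : knuth_eq u v -> knuth_eq v u
| knuth_trans u v w : knuth_eq u v -> knuth_eq v w -> knuth_eq u w.

Definition colword (T : seq (seq nat)) : seq nat := flatten [seq rev C | C <- T].

(* A frank word for lam in the plactic class of T, given by its column
   factorization fs: each factor is a column (strictly decreasing word), the
   factor lengths are a rearrangement of the column lengths of lam, and the
   word is Knuth equivalent to the reading word of T. *)
Definition frank_fact (lam : seq nat) (T : seq (seq nat)) (fs : seq (seq nat))
  : Prop :=
  all (sorted gtn) fs /\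
  perm_eq (map size fs) [seq collen lam j | j <- iota 1 (lam1 lam)] /\
  knuth_eq (flatten fs) (colword T).

(* K is the right key of T (Lascoux--Schuetzenberger): K has lam_1 columns
   and, for every j, column j of K (length c_j) is the set of letters of the
   last column of a frank word in the class of T whose last column has length
   c_j (listed increasingly, top to bottom). *)
Definition is_right_key (lam : seq nat) (T K : seq (seq nat)) : Prop :=
  size K = lam1 lam /\
  forall j, 1 <= j <= lam1 lam ->
    exists fs, frank_fact lam T fs /\
      size (last [::] fs) = collen lam j /\
      column K j = rev (last [::] fs).

Definition in_D (n : nat) (lam : seq nat) (w : seq nat) (T : seq (seq nat))
  : Prop :=
  is_SSYT n lam T /\
  exists K, is_right_key lam T K /\ tab_le lam K (Ykey lam w).

Definition pi_init (n : nat) (T : seq (seq nat)) : seq nat :=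
  column T 1 ++ [seq x <- iota 1 n | x \notin column T 1].

(* Given the current value v = pi_{i_{x-1}} < t, find the successive indices
   i_x (0-based positions; "index > c_j" means 0-based position >= c_j),
   the smallest with v < pi_{i_x} <= t, stopping when pi_{i_m} = t.
   Returns None if the chain breaks down (never happens for the procedure,
   by the paper's analysis). *)
Fixpoint greedy_chain (fuel : nat) (pi : seq nat) (cj t v : nat)
  : option (seq nat) :=
  match fuel with
  | 0 => None
  | f.+1 =>
    match [seq q <- iota 0 (size pi) |
            (cj <= q) && (v < nth 0 pi q) && (nth 0 pi q <= t)] with
    | [::] => None
    | q :: _ =>
      if nth 0 pi q == t then Some [:: q]
      else omap (cons q) (greedy_chain f pi cj t (nth 0 pi q))
    end
  end.

Definition assign (pi : seq nat) (ps vs : seq nat) : seq nat :=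
  foldl (fun s pv => set_nth 0 s pv.1 pv.2) pi (zip ps vs).

Definition greedy_step (n : nat) (lam : seq nat) (T : seq (seq nat))
  (pi : seq nat) (ji : nat * nat) : seq nat :=
  let j := ji.1 in let i := ji.2 in
  let t := entry T j i in
  if entry T j.-1 i == t then pi
  else
    match greedy_chain n pi (collen lam j) t (nth 0 pi i.-1) with
    | None => pi
    | Some l =>
      let ps := i.-1 :: l in
      (* pi'_{i_x} = pi_{i_{x-1}}, pi'_{i_0} = pi_{i_m} *)
      assign pi ps (rotr 1 (map (nth 0 pi) ps))
    end.

Definition greedy_locs (lam : seq nat) : seq (nat * nat) :=
  flatten [seq [seq (j, i) | i <- rev (iota 1 (collen lam j))]
          | j <- iota 2 (lam1 lam).-1].

Definition piT (n : nat) (lam : seq nat) (T : seq (seq nat)) : seq nat :=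
  foldl (greedy_step n lam T) (pi_init n T) (greedy_locs lam).

(* Main.v *)
Require Import Defs.
From mathcomp Require Import all_boot zify.
Set Implicit Arguments. Unset Strict Implicit. Unset Printing Implicit Defensive.

(* Let [c] be a column length.  If [u] is a frank word whose last column [f] has
   length [c], then [c] disjoint weakly increasing subsequences of [u] of maximal
   total length exhaust [f]; hence a column [v] of length [c] lies entrywise
   above [f] iff this maximum grows by [c] when [v] is appended to [u].  The
   maximum is a plactic (Greene) invariant, so [f] depends only on [c] and the
   plactic class.  Moving column [j] of [T] to the end by two-column slides yields
   one such frank word; its last column arises from column [j] by letting each
   letter [t] of the later columns, in reading order, replace the largest letter
   [<= t].  The greedy procedure acts in the same way on the set of the first [c]
   entries of the permutation, so the right key of [T] is the key of [pi_T].
   Finally [pi_T] increases on the blocks of [lam], so comparing keys with [w]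
   amounts to the tableau criterion for the Bruhat order. *)

(** * Domination and the Bruhat order *)

(** Counting form of the entrywise order: for sorted lists of equal size it says that [e1] lies
    below [e2]. It is insensitive to permutations and lets [e1] be the longer list. *)
Definition dom (e1 e2 : seq nat) : Prop :=
  forall q, count (leq^~ q) e2 <= count (leq^~ q) e1.

Lemma dom_trans e1 e2 e3 : dom e1 e2 -> dom e2 e3 -> dom e1 e3.
Proof. by move=> h1 h2 q; apply: leq_trans (h1 q). Qed.

Lemma perm_dom e1 e2 : perm_eq e1 e2 -> dom e1 e2.
Proof. by move=> /permP h q; rewrite h. Qed.

Lemma dom_cons a b r s : a <= b -> dom r s -> dom (a :: r) (b :: s).
Proof. by move=> ab h q /=; have := h q; lia. Qed.

Lemma nth_le_count s p x : sorted leq s -> p < size s ->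
  (nth 0 s p <= x) = (p < count (leq^~ x) s).
Proof.
elim: s p => [|a s IH] p //= pa.
have ha : all (leq a) s by apply: order_path_min pa; exact: leq_trans.
have [ax|ax] := leqP a x.
  case: p => [|p] /= lps; first by rewrite ax; lia.
  by rewrite IH ?(path_sorted pa) // add1n.
have -> : count (leq^~ x) s = 0.
  apply/eqP; rewrite -leqn0 leqNgt -has_count; apply/hasPn => y /(allP ha) /=.
  by lia.
rewrite addn0 ltn0; case: p => [|p] /= lps; apply/negbTE; rewrite -ltnNge //.
exact: leq_trans ax (allP ha _ (mem_nth 0 lps)).
Qed.

Lemma dom_nth A B p : sorted leq A -> sorted leq B -> size B <= size A ->
  dom A B -> p < size B -> nth 0 A p <= nth 0 B p.
Proof.
move=> sA sB szAB dAB pB.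
have h : p < count (leq^~ (nth 0 B p)) B by rewrite -nth_le_count.
by rewrite nth_le_count ?(leq_trans h (dAB _)) // (leq_trans pB).
Qed.

Lemma nth_dom A B : size B <= size A ->
  (forall p, p < size B -> nth 0 A p <= nth 0 B p) -> dom A B.
Proof.
elim: B A => [|b B IH] [|a A] //= szAB h q //=.
have := IH A szAB (fun p => h p.+1) q; have := h 0 isT; rewrite /=; lia.
Qed.

Lemma count_le_subset A B q : uniq B -> {subset B <= A} ->
  count (leq^~ q) B <= count (leq^~ q) A.
Proof.
move=> uB sBA; rewrite -!size_filter; apply: uniq_leq_size.
  exact: filter_uniq.
by move=> x; rewrite !mem_filter => /andP[-> /sBA].
Qed.

Lemma dom_antisym_sorted A B : sorted ltn A -> sorted ltn B ->
  size A = size B -> dom A B -> dom B A -> A = B.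
Proof.
move=> sA sB szE dAB dBA.
have sA' : sorted leq A by apply: sub_sorted sA => x y; exact: ltnW.
have sB' : sorted leq B by apply: sub_sorted sB => x y; exact: ltnW.
apply: (@eq_from_nth _ 0) => // i iA; apply/eqP; rewrite eqn_leq.
by rewrite !dom_nth ?szE // -szE.
Qed.

Lemma swap_cons x u a b : swap (x :: u) a.+1 b.+1 = x :: swap u a b.
Proof. by []. Qed.

Lemma swap_cat s0 x s1 z s2 :
  swap (s0 ++ x :: s1 ++ z :: s2) (size s0) (size s0 + (size s1).+1) =
  s0 ++ z :: s1 ++ x :: s2.
Proof.
elim: s0 => [|y s0 IH]; last by rewrite /= swap_cons IH.
rewrite /swap /= nth_cat ltnn subnn /=; congr cons.
by elim: s1 => //= y s1 ->.
Qed.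

Lemma bruhat_step_cons x u v : bruhat_step u v -> bruhat_step (x :: u) (x :: v).
Proof.
move=> [a [b [/andP[ab bu] [uab ->]]]]; exists a.+1, b.+1.
by split; [apply/andP | split].
Qed.

Lemma bruhat_le_cons x u v : bruhat_le u v -> bruhat_le (x :: u) (x :: v).
Proof.
elim=> [w|u1 v1 w st _ IH]; first exact: bruhat_refl.
by apply: bruhat_trans IH; apply: bruhat_step_cons.
Qed.

(** Only prefixes that end between the two swapped positions change as multisets; there the smaller
    letter gives way to the larger one. *)
Lemma bruhat_step_dom u v p : bruhat_step u v -> dom (take p u) (take p v).
Proof.
move=> [a [b [/andP[ab bu] [uab ->]]]].
have [s0 [x [s1 [z [s2 [E sa sb]]]]]] :
    exists s0 x s1 z s2, [/\ u = s0 ++ x :: s1 ++ z :: s2,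
      a = size s0 & b = size s0 + (size s1).+1].
  exists (take a u), (nth 0 u a), (take (b - a).-1 (drop a.+1 u)), (nth 0 u b),
    (drop b.+1 u).
  have szd : (b - a).-1 <= size (drop a.+1 u) by rewrite size_drop; lia.
  rewrite !size_takel ?szd //; last by lia.
  split=> //; last by lia.
  rewrite -[LHS](cat_take_drop a); congr cat.
  rewrite (drop_nth 0); last by lia.
  congr cons; rewrite -[LHS](cat_take_drop (b - a).-1); congr cat.
  rewrite drop_drop (_ : (b - a).-1 + a.+1 = b); last by lia.
  exact: drop_nth.
have xz : x < z.
  have Ea : nth 0 u a = x by rewrite E sa nth_cat ltnn subnn.
  have Eb : nth 0 u b = z.
    rewrite E sb nth_cat ifF; last by lia.
    by rewrite addKn /= nth_cat ltnn subnn.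
  by rewrite -Ea -Eb.
rewrite E sa sb swap_cat.
elim: s0 p {E sa sb} => [|y s0 IH] [|p] q //=; last by rewrite leq_add2l; apply: IH.
rewrite !take_cat; case: ifP => _; first by lia.
case: (p - _) => [|k] /=; rewrite !count_cat /=; lia.
Qed.

Lemma bruhat_le_dom u v p : bruhat_le u v -> dom (take p u) (take p v).
Proof.
elim=> [w q //|u1 v1 w st _ IH].
exact: dom_trans (bruhat_step_dom p st) IH.
Qed.

Lemma split_first (P : pred nat) (s : seq nat) : has P s ->
  exists s1 z s2, [/\ s = s1 ++ z :: s2, P z & all (predC P) s1].
Proof.
elim: s => //= a s IH; case: (boolP (P a)) => [Pa _|nPa /= /IH].
  by exists [::], a, s.
by move=> [s1 [z [s2 [-> Pz h]]]]; exists (a :: s1), z, s2; rewrite /= nPa.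
Qed.

(* At the first disagreement [x < y] one may swap [x] with the first later
   letter in the interval from [x] (excluded) to [y]. *)
Lemma dom_bruhat_le (u w : seq nat) : perm_eq u w ->
  (forall p, dom (take p u) (take p w)) -> bruhat_le u w.
Proof.
elim: w u => [|y w IHw] u puw; first by rewrite (perm_nilP puw) => _; constructor.
case: u puw => [|x u puw D]; first by move=> /perm_size.
have xy : x <= y by have := D 1 y; rewrite /= !take0 /=; lia.
(* Induction on the gap [y - x]: the swap puts some [z] with [x < z <= y] in front, so the gap
   shrinks. *)
have [m ym] := ubnPleq (y - x).
elim: m x u puw D xy ym => [|m IHm] x u puw D xy ym.
  have E : x = y by lia.
  rewrite -E; apply: bruhat_le_cons; apply: IHw.
    by move: puw; rewrite E perm_cons.
  by move=> p q; have := D p.+1 q; rewrite /= E leq_add2l.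
have [E|nxy] := eqVneq x y.
  by apply: IHm => //; rewrite E subnn.
have yu : y \in u.
  have : y \in x :: u by rewrite (perm_mem puw) mem_head.
  by rewrite inE eq_sym (negbTE nxy).
have /split_first[s1 [z [s2 [E /andP[xz zy] s1P]]]] :
    has (fun z => x < z <= y) u.
  by apply/hasP; exists y => //; rewrite leqnn andbT ltn_neqAle nxy.
subst u; apply: (@bruhat_trans _ (z :: s1 ++ x :: s2)).
  exists 0, (size s1).+1; split; first by rewrite /= size_cat /=; lia.
  split; first by rewrite /= nth_cat ltnn subnn.
  by rewrite (swap_cat [::]).
apply: IHm => //; last by lia.
  rewrite -(permPr puw) -!cat_cons; apply/permP => P; rewrite !count_cat /=; lia.
case=> [|p] q //=; have /= := D p.+1 q; have /= := D p.+1 y; rewrite leqnn.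
have [ps1|s1p] := leqP p (size s1); last first.
  rewrite !take_cat ltnNge (ltnW s1p) /= -(subnSK s1p) /= !count_cat /=; lia.
rewrite !takel_cat // => Dy Dq.
have [xq|xq] := leqP x q; last by lia.
have [zq|zq] := leqP z q; first by lia.
(* Here [x <= q < z]. As [s1] has no letter in the interval from [x] (excluded) to [y], the
   hypothesis at [y] yields the bound at [q]. *)
have E1 : count (leq^~ q) (take p s1) = count (leq^~ y) (take p s1).
  apply: eq_in_count => a /mem_take /(allP s1P) /=; lia.
have : count (leq^~ q) (take p w) <= count (leq^~ y) (take p w).
  by apply: sub_count => a /=; lia.
lia.
Qed.

Lemma count_take_S (P : pred nat) s p : p < size s ->
  count P (take p.+1 s) = count P (take p s) + P (nth 0 s p).
Proof. by move=> ps; rewrite (take_nth 0) // -cats1 count_cat /= addn0. Qed.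

(* An increasing block of [u] either stays below [q] up to position [p], or
   stays above [q] from [p] on, so the comparison at [p] follows from the one
   at an end of the block. *)
Lemma dom_take_blocks (good : pred nat) (u w : seq nat) : size u = size w ->
  (forall p, 0 < p < size u -> good p -> dom (take p u) (take p w)) ->
  perm_eq u w ->
  (forall p, 0 < p < size u -> ~~ good p -> nth 0 u p.-1 < nth 0 u p) ->
  forall p, dom (take p u) (take p w).
Proof.
move=> szE Dg puw inc.
have mono (P : pred nat) (s : seq nat) a : count P (take a s) <= count P (take a.+1 s).
  have [as_|sa] := ltnP a (size s); first by rewrite count_take_S // leq_addr.
  by rewrite !take_oversize // ltnW.
have below q p : p < size u -> nth 0 u p <= q ->
    count (leq^~ q) (take p.+1 w) <= count (leq^~ q) (take p.+1 u).
  elim: p => [|p IH] pu upq.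
    by rewrite !count_take_S ?take0 -?szE //= upq leq_b1.
  have Ew : count (leq^~ q) (take p.+2 w) <= (count (leq^~ q) (take p.+1 w)).+1.
    by rewrite count_take_S -?szE // -[X in _ <= X]addn1 leq_add2l leq_b1.
  have Eu : count (leq^~ q) (take p.+2 u) = (count (leq^~ q) (take p.+1 u)).+1.
    by rewrite count_take_S //= upq addn1.
  rewrite Eu; apply: leq_trans Ew _; rewrite ltnS.
  have [g|ng] := boolP (good p.+1); first exact: Dg.
  by apply: IH; [exact: ltnW | have /= := inc p.+1 pu ng; lia].
have above q m p : size u - p = m -> p < size u -> q < nth 0 u p ->
    count (leq^~ q) (take p.+1 w) <= count (leq^~ q) (take p.+1 u).
  elim: m p => [|m IH] p; first by lia.
  move=> Em pu qup; have [pu1|up1] := ltnP p.+1 (size u); last first.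
    by rewrite !take_oversize -?szE // (permP puw).
  have [g|ng] := boolP (good p.+1); first exact: Dg.
  have /= h := inc p.+1 pu1 ng.
  have hq : q < nth 0 u p.+1 by lia.
  apply: leq_trans (mono _ w p.+1) _.
  apply: (leq_trans (IH p.+1 _ pu1 hq)); first by lia.
  by rewrite [X in X <= _]count_take_S //= [nth 0 u p.+1 <= q]leqNgt hq addn0.
case=> [|p] q; first by rewrite !take0.
have [pu|up] := ltnP p (size u); last first.
  by rewrite !take_oversize -?szE ?(permP puw) // leqW.
by have [h|h] := leqP (nth 0 u p) q; [apply: below | apply: above h].
Qed.

(** * Increasing subsequences and Knuth equivalence *)

(** Reduces a permutation goal to linear arithmetic on the counts of an arbitrary predicate, using
    the permutations in the context. *)
Ltac perm_lia :=
  let P := fresh in apply/permP => P;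
  repeat match goal with
  | H : is_true (perm_eq _ _) |- _ => move/permP/(_ P): H
  end; rewrite /= ?count_cat /= ?count_cat /=; clear; lia.

(** The value defaults to [0] when no letter of [s] is [<= t]. *)
Definition pmax (t : nat) (s : seq nat) : nat := \max_(y <- s | y <= t) y.

Lemma pmax_ub t s y : y \in s -> y <= t -> y <= pmax t s.
Proof. by move=> ys yt; apply: (leq_bigmax_seq (F := id)). Qed.

Lemma pmax_le t s : pmax t s <= t.
Proof. by apply/bigmax_leqP_seq. Qed.

Lemma pmax_mem t s y : y \in s -> y <= t -> pmax t s \in s.
Proof.
elim: s y => // a s IH y ys yt; rewrite /pmax big_cons -/(pmax t s).
have [/hasP[b bs bt]|/hasPn ns] := boolP (has (leq^~ t) s).
  by rewrite !inE; case: ifP => _; rewrite ?(IH b) ?orbT // /maxn; case: ifP;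
    rewrite ?(IH b) ?orbT ?eqxx.
have a_t : a <= t.
  by move: ys; rewrite inE => /orP[/eqP<- //|/ns]; rewrite yt.
rewrite a_t (_ : pmax t s = 0) ?maxn0 ?mem_head // /pmax big_seq_cond.
by rewrite big_pred0 // => b; apply/negP => /andP[/ns /negP].
Qed.

Lemma pmax_eq t s m : m \in s -> m <= t ->
  (forall y, y \in s -> y <= t -> y <= m) -> pmax t s = m.
Proof.
move=> ms mt ub; apply/eqP; rewrite eqn_leq pmax_ub // andbT.
by apply: ub (pmax_le t s); apply: pmax_mem ms mt.
Qed.

Lemma perm_cons_cons (x b : nat) (r s : seq nat) : perm_eq (x :: r) (b :: s) ->
  (x = b /\ perm_eq r s) \/
  exists r', perm_eq r (b :: r') /\ perm_eq s (x :: r').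
Proof.
have [<-|nxb] := eqVneq x b; first by rewrite perm_cons; left.
move=> H; right; have br : b \in r.
  have := mem_head b s; rewrite -(perm_mem H) inE eq_sym (negbTE nxb).
  by [].
have H2 := perm_to_rem br; exists (rem b r); split=> //; perm_lia.
Qed.

(* [run e u N e']: the [size e] weakly increasing chains whose current last
   letters are [e] can be extended along [u], using [N] letters of [u] in all,
   so as to end with last letters [e']. *)
Inductive run : seq nat -> seq nat -> nat -> seq nat -> Prop :=
| run_nil e : run e [::] 0 e
| run_skip e x u N e' : run e u N e' -> run e (x :: u) N e'
| run_hit e x u N e' y r : perm_eq e (y :: r) -> y <= x ->
    run (x :: r) u N e' -> run e (x :: u) N.+1 e'.

Lemma run_nilE e N e' : run e [::] N e' -> N = 0 /\ e' = e.
Proof. by move=> H; inversion H. Qed.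

Lemma run_consE e x u N e' : run e (x :: u) N e' -> run e u N e' \/
  exists y r M, [/\ N = M.+1, perm_eq e (y :: r), y <= x & run (x :: r) u M e'].
Proof.
move=> H; inversion H as [|? ? ? ? ? H1|? ? ? M ? y r H1 H2 H3]; subst.
  by left.
by right; exists y, r, M.
Qed.

Lemma run_cat e u v N1 N2 e1 e2 :
  run e u N1 e1 -> run e1 v N2 e2 -> run e (u ++ v) (N1 + N2) e2.
Proof.
move=> H; elim: H v N2 e2 => [//||]; first by move=> *; apply: run_skip; auto.
by move=> f x w N f' y r pr yx _ IH v N2 e2 H; apply: run_hit pr yx _; apply: IH.
Qed.

Lemma run_catE e u v N e2 : run e (u ++ v) N e2 ->
  exists e1 N1 N2, [/\ N = N1 + N2, run e u N1 e1 & run e1 v N2 e2].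
Proof.
elim: u e N => [|x u IH] e N /= H; first by exists e, 0, N; split=> //; constructor.
case: (run_consE H) => [/IH|[y [r [M [-> pr yx /IH]]]]].
  by move=> [e1 [N1 [N2 [-> H1 H2]]]]; exists e1, N1, N2; split=> //; apply: run_skip.
move=> [e1 [N1 [N2 [-> H1 H2]]]]; exists e1, N1.+1, N2; split=> //.
exact: run_hit pr yx H1.
Qed.

Lemma run_size e u N e' : run e u N e' -> size e' = size e.
Proof. by elim=> // f x w M f' y r /perm_size -> _ _ ->. Qed.

(** The greedy choice works: extend the chain of [e1] with the largest last letter [<= x], which
    leaves the smallest possible state. *)
Lemma dom_hit e1 e2 x y r : dom e1 e2 -> perm_eq e2 (y :: r) -> y <= x ->
  exists y1 r1, [/\ perm_eq e1 (y1 :: r1), y1 <= x & dom (x :: r1) (x :: r)].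
Proof.
move=> D pr yx.
have /hasP[a ae ax] : has (leq^~ x) e1.
  by rewrite has_count; apply: leq_trans (D x); rewrite (permP pr) /= yx.
have me := pmax_mem ae ax; have p1 := perm_to_rem me.
have mx := pmax_le x e1.
exists (pmax x e1), (rem (pmax x e1) e1); split=> // q /=.
have := D q; have := D x; move/permP: (p1) => p1'; move/permP: pr => pr'.
have := p1' (leq^~ q); have := p1' (leq^~ x).
rewrite !pr' /= mx yx.
have [xq|qx] := leqP x q; first by rewrite (leq_trans mx xq) (leq_trans yx xq); lia.
have [mq|qm] := leqP (pmax x e1) q; last by lia.
(* Now [pmax x e1 <= q < x]: every letter of [e1] up to [x] is already up to [q], so domination at
   [x] is what is needed. *)
have E : count (leq^~ q) e1 = count (leq^~ x) e1.
  apply: eq_in_count => b be /=; have := pmax_ub (t := x) be; lia.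
have : count (leq^~ q) r <= count (leq^~ x) r.
  by apply: sub_count => b /=; lia.
lia.
Qed.

Lemma run_mono e1 e2 u N e2' : dom e1 e2 -> run e2 u N e2' ->
  exists e1', run e1 u N e1' /\ dom e1' e2'.
Proof.
move=> D H; elim: H e1 D => [e|e x w M f _ IH|e x w M f y r pr yx _ IH] e1 D.
- by exists e1; split=> //; constructor.
- by have [f1 [H1 H2]] := IH _ D; exists f1; split=> //; apply: run_skip.
have [y1 [r1 [p1 y1x D1]]] := dom_hit D pr yx.
have [f1 [H1 H2]] := IH _ D1; exists f1; split=> //; exact: run_hit p1 y1x H1.
Qed.

(** A form of Greene's invariance strong enough to pass through contexts: the initial state is
    arbitrary, and the final one may only get smaller. *)
Definition simulates (u v : seq nat) : Prop :=
  forall e N e', run e u N e' -> exists e'', run e v N e'' /\ dom e'' e'.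

Lemma simulates_trans u v w : simulates u v -> simulates v w -> simulates u w.
Proof.
move=> h1 h2 e N e' /h1[e1 [/h2[e2 [H2 D2]] D1]]; exists e2; split=> //.
exact: dom_trans D2 D1.
Qed.

Lemma simulates_ctx p q u v : simulates u v -> simulates (p ++ u ++ q) (p ++ v ++ q).
Proof.
move=> h e N e' /run_catE[e1 [N1 [N2 [-> H1]]]].
move=> /run_catE[e2 [N3 [N4 [-> /h[f2 [H3 D]] H4]]]].
have [f [Hf Df]] := run_mono D H4; exists f; split=> //.
by apply: run_cat H1 _; apply: run_cat H3 _.
Qed.

Lemma run_dom e v N e' f : run e v N e' -> dom e' f ->
  exists e'', run e v N e'' /\ dom e'' f.
Proof. by exists e'. Qed.

(** No chain takes [z] and then the smaller [x], so the two letters extend different chains and can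
    be read in either order. *)
Lemma simulates_descent x z : x < z -> simulates [:: z; x] [:: x; z].
Proof.
move=> xz e N e' /run_consE[/run_consE[/run_nilE[-> ->]|]|].
- by exists e; split=> //; do 2 apply: run_skip; constructor.
- move=> [y [r [M [-> pr yx /run_nilE[-> ->]]]]]; exists (x :: r); split=> //.
  by apply: run_hit pr yx _; apply: run_skip; constructor.
move=> [b [r [M [-> pr bz /run_consE[/run_nilE[-> ->]|]]]]].
  exists (z :: r); split=> //; apply: run_skip; apply: run_hit pr bz _; constructor.
move=> [a [s [K [-> ps ax /run_nilE[-> ->]]]]].
have [[E _]|[r' [p1 p2]]] := perm_cons_cons ps; first by lia.
apply: (run_dom (e' := z :: x :: r')).
  apply: (@run_hit _ _ _ _ _ a (b :: r')) => //; first by perm_lia.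
  by apply: (@run_hit _ _ _ _ _ b (x :: r')) => //; [perm_lia | constructor].
by apply: perm_dom; perm_lia.
Qed.

(** The second alternative, a single chain taking both letters, is the only case in which their
    order matters. *)
Lemma run_pair e x z N e' : run e [:: x; z] N e' ->
  (exists e'', run e [:: z; x] N e'' /\ dom e'' e') \/
  (exists a r, [/\ N = 2, perm_eq e (a :: r), a <= x & perm_eq e' (z :: r)]).
Proof.
move=> /run_consE[/run_consE[/run_nilE[-> ->]|]|].
- by left; exists e; split=> //; do 2 apply: run_skip; constructor.
- move=> [y [r [M [-> pr yz /run_nilE[-> ->]]]]]; left; exists (z :: r).
  by split=> //; apply: run_hit pr yz _; apply: run_skip; constructor.
move=> [a [r [M [-> pr ax /run_consE[/run_nilE[-> ->]|]]]]].
  left; exists (x :: r); split=> //; apply: run_skip; apply: run_hit pr ax _.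
  by constructor.
move=> [b [s [K [-> ps bz /run_nilE[-> ->]]]]].
have [[E p1]|[r' [p1 p2]]] := perm_cons_cons ps.
  by right; exists a, r; split=> //; perm_lia.
left; apply: (run_dom (e' := x :: z :: r')); last by apply: perm_dom; perm_lia.
apply: (@run_hit _ _ _ _ _ b (a :: r')) => //; first by perm_lia.
by apply: (@run_hit _ _ _ _ _ a (z :: r')) => //; [perm_lia | constructor].
Qed.

(* If a chain uses [x z], then either [y] is free and replaces [x], or the
   chains through [y] and through [x z] exchange their tails. *)
Lemma simulates_knuth2 x y z : x < y <= z -> simulates [:: y; x; z] [:: y; z; x].
Proof.
move=> /andP[xy yz] e N e' /(@run_catE _ [:: y])[e1 [N1 [N2 [-> H1 H2]]]].
have [[e2 [H3 D]]|[a [r [-> pa ax pe']]]] := run_pair H2.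
  by apply: run_dom D; apply: (@run_cat _ [:: y]) H3.
case: (run_consE H1) => [/run_nilE[-> E]|[c [s [M [-> pc cy /run_nilE[-> E]]]]]].
  apply: (run_dom (e' := z :: r)); last by apply: perm_dom; perm_lia.
  apply: (@run_hit _ _ _ _ _ a r); [by rewrite -E|lia|].
  by apply: (@run_hit _ _ _ _ _ y r) => //; apply: run_skip; constructor.
move: pa; rewrite E => pa.
have [[E2 _]|[r' [p1 p2]]] := perm_cons_cons pa; first by lia.
apply: (run_dom (e' := x :: z :: r')); last first.
  apply: (@dom_trans _ (y :: z :: r')); first by apply: dom_cons; [lia|].
  by apply: perm_dom; perm_lia.
apply: run_hit pc cy _; apply: (@run_hit _ _ _ _ _ y (a :: r')) => //.
  by perm_lia.
by apply: (@run_hit _ _ _ _ _ a (z :: r')) => //; [perm_lia | constructor].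
Qed.

(** If a chain uses [x z], then either [y] is free and replaces [z], or the chain through [y] takes
    [z] instead and the chain through [x] goes on to [y]. *)
Lemma simulates_knuth1 x y z : x <= y < z -> simulates [:: x; z; y] [:: z; x; y].
Proof.
move=> /andP[xy yz] e N e' /(@run_catE _ [:: x; z])[e1 [N1 [N2 [-> H1 H2]]]].
have [[e2 [H3 D]]|[a [r [-> pa ax pe1]]]] := run_pair H1.
  have [f [Hf Df]] := run_mono D H2.
  by apply: run_dom Df; apply: (@run_cat _ [:: z; x]) H3 Hf.
case: (run_consE H2) => [/run_nilE[-> ->]|[b [s [M [-> pb b_y /run_nilE[-> ->]]]]]].
  apply: (run_dom (e' := y :: r)); last first.
    apply: (@dom_trans _ (z :: r)); first by apply: dom_cons; [lia|].
    by apply: perm_dom; perm_lia.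
  apply: run_skip; apply: run_hit pa ax _.
  by apply: (@run_hit _ _ _ _ _ x r) => //; constructor.
have : perm_eq (z :: r) (b :: s) by perm_lia.
move=> /perm_cons_cons[[E _]|[r' [p1 p2]]]; first by lia.
apply: (run_dom (e' := y :: z :: r')); last by apply: perm_dom; perm_lia.
apply: (@run_hit _ _ _ _ _ b (a :: r')); [by perm_lia|lia|].
apply: (@run_hit _ _ _ _ _ a (z :: r')) => //; first by perm_lia.
by apply: (@run_hit _ _ _ _ _ x (z :: r')) => //; constructor.
Qed.

Lemma knuth_simulates u v : knuth_eq u v -> simulates u v /\ simulates v u.
Proof.
elim=> {u v} [u|u v H|u v _ [h1 h2]|u v w _ [h1 h2] _ [h3 h4]] //.
- by split=> e N e' H; exists e'; split.
- case: H => p q x y z h; split; apply: simulates_ctx.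
  + exact: simulates_knuth1.
  (* Read backwards, each Knuth move only turns the descent [z x] into [x z], beside an untouched
     [y]. *)
  + apply: (@simulates_ctx [::] [:: y] [:: z; x] [:: x; z]); apply: simulates_descent; lia.
  + exact: simulates_knuth2.
  + apply: (@simulates_ctx [:: y] [::] [:: z; x] [:: x; z]); apply: simulates_descent; lia.
- by split; [apply: simulates_trans h3 | apply: simulates_trans h2].
Qed.

Lemma knuth_cat p q u v : knuth_eq u v -> knuth_eq (p ++ u ++ q) (p ++ v ++ q).
Proof.
elim=> {u v} [u|u v [] a b x y z h|u v _|u v w _ h1 _ h2].
- exact: knuth_refl.
- have := knuth1 (p ++ a) (b ++ q) h; rewrite -!catA; exact: knuth_step.
- have := knuth2 (p ++ a) (b ++ q) h; rewrite -!catA; exact: knuth_step.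
- exact: knuth_sym.
- exact: knuth_trans h1 h2.
Qed.

(* A strictly decreasing word meets every chain at most once. *)
Lemma run_column e D N e' : sorted gtn D -> run e D N e' ->
  exists s h r : seq nat, [/\ subseq s D, size s = N, all2 leq h s,
    perm_eq e (h ++ r) & perm_eq e' (s ++ r)].
Proof.
elim: D e N => [|x D IH] e N sD.
  by move=> /run_nilE[-> ->]; exists [::], [::], e; split.
have D_x : all (gtn x) D by apply: order_path_min sD => a b c /=; lia.
have sD' := path_sorted sD.
case/run_consE=> [/IH[//|s [h [r [H1 H2 H3 H4 H5]]]]|].
  by exists s, h, r; split=> //; apply: subseq_trans H1 (subseq_cons _ _).
move=> [y [r0 [M [-> pe yx /IH[//|s [h [r [H1 H2 H3 H4 H5]]]]]]]].
(* All later letters are smaller than [x], so the chain now ending in [x] is not extended again. *)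
have xh : x \notin h.
  apply/negP => xh; have : has (leq x) s.
    elim: h s H3 xh {H1 H2 H4 H5} => [|a h IHh] [|b s] //= /andP[ab /IHh{}IHh].
    by rewrite inE => /orP[/eqP->|/IHh ->]; rewrite ?ab ?orbT.
  by move=> /hasP[b /(mem_subseq H1) /(allP D_x) /=]; lia.
have xr : x \in r.
  by have := mem_head x r0; rewrite (perm_mem H4) mem_cat (negbTE xh).
have p1 := perm_to_rem xr.
exists (x :: s), (y :: h), (rem x r); split.
- by rewrite /= eqxx.
- by rewrite /= H2.
- by rewrite /= yx.
- perm_lia.
- perm_lia.
Qed.

Lemma run_column_le e D N e' : sorted gtn D -> run e D N e' ->
  N <= minn (size e) (size D).
Proof.
move=> sD /run_column[//|s [h [r [H1 <- H3 H4 H5]]]].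
rewrite leq_min (size_subseq H1) (perm_size H4) size_cat.
by move: H3; rewrite all2E => /andP[/eqP-> _]; rewrite leq_addr.
Qed.

(** With as many chains as letters and every letter used, no chain is left over: each one passes
    from a letter of [e] to a letter of [D] above it. *)
Lemma run_column_full e D e' : sorted gtn D -> size e = size D ->
  run e D (size D) e' -> perm_eq e' D /\ dom e D.
Proof.
move=> sD szE /run_column[//|s [h [r [H1 H2 H3 H4 H5]]]].
have szh : size h = size s by move: H3; rewrite all2E => /andP[/eqP-> _].
have := perm_size H4; rewrite size_cat szE szh H2 => szr.
have r0 : r = [::] by apply/size0nil/(@addnI (size D)); rewrite addn0.
move: H4 H5; rewrite r0 !cats0 => H4 H5.
have sE : s = D by apply/eqP; rewrite -(size_subseq_leqif H1) H2.
split; first by rewrite -sE.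
apply: (dom_trans (perm_dom H4)); rewrite -sE.
elim: h s H3 {H1 H2 H4 H5 szh sE} => [|a h IHh] [|b s] //= /andP[ab /IHh{}IHh].
exact: dom_cons.
Qed.

(** The bound on what [k] chains can take from columns, each chain meeting a column at most once.
    For the column lengths of a partition it is the sum of the first [k] parts, as in Greene's
    theorem. *)
Definition fullcount (k : nat) (fs : seq (seq nat)) : nat :=
  sumn [seq minn k (size f) | f <- fs].

Lemma run_columns_le e fs N e' : all (sorted gtn) fs -> run e (flatten fs) N e' ->
  N <= fullcount (size e) fs.
Proof.
elim: fs e N => [|f fs IH] e N /=; first by move=> _ /run_nilE[->].
move=> /andP[sf sfs] /run_catE[e1 [N1 [N2 [-> H1 H2]]]].
have := IH _ _ sfs H2; rewrite (run_size H1) => h2.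
exact: leq_add (run_column_le sf H1) h2.
Qed.

Lemma fullcount_rcons k fs f :
  fullcount k (rcons fs f) = fullcount k fs + minn k (size f).
Proof. by rewrite /fullcount map_rcons sumn_rcons. Qed.

(** Equality in the total bound forces equality on the last column, which has one letter for each
    chain and so becomes the whole state. *)
Lemma run_columns_full e fs f e' : all (sorted gtn) (rcons fs f) ->
  size f = size e ->
  run e (flatten (rcons fs f)) (fullcount (size e) (rcons fs f)) e' ->
  perm_eq e' f.
Proof.
rewrite all_rcons => /andP[sf sfs] szf; rewrite flatten_rcons fullcount_rcons.
move=> /run_catE[e1 [N1 [N2 [EN H1 H2]]]].
have := run_columns_le sfs H1; have := run_column_le sf H2.
have sz1 := run_size H1; move: EN; rewrite sz1 szf minnn => EN h2 h1.
have E2 : N2 = size f by lia.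
by move: H2; rewrite E2 => /(run_column_full sf)[|//]; rewrite sz1.
Qed.

(** Chains increase weakly, so each letter can extend the chain that already ends in it. *)
Lemma run_self D : sorted gtn D -> forall r, exists e', run (D ++ r) D (size D) e'.
Proof.
elim: D => [|x D IH] sD r; first by exists r; constructor.
have [e1 H1] := IH (path_sorted sD) (x :: r).
have [|e2 [H2 _]] := run_mono (e1 := x :: D ++ r) _ H1.
  by apply: perm_dom; perm_lia.
by exists e2; apply: (@run_hit _ _ _ _ _ x (D ++ r)).
Qed.

(* The full run over [flatten fs] has final state the last column [f], hence
   extends over another copy of [f]; transported to [flatten gs], it forces the
   last column [g] to be dominated by [f]. *)
Lemma last_column_dom e fs f gs g e' :
  all (sorted gtn) (rcons fs f) -> all (sorted gtn) (rcons gs g) ->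
  size f = size e -> size g = size e ->
  fullcount (size e) (rcons fs f) = fullcount (size e) (rcons gs g) ->
  knuth_eq (flatten (rcons fs f)) (flatten (rcons gs g)) ->
  run e (flatten (rcons fs f)) (fullcount (size e) (rcons fs f)) e' ->
  dom g f.
Proof.
move=> sfs sgs szf szg Efull Hk H.
have sf : sorted gtn f by move: sfs; rewrite all_rcons => /andP[].
have sg : sorted gtn g by move: sgs; rewrite all_rcons => /andP[].
have pe' := run_columns_full sfs szf H.
have [e1 H1] := run_self sf [::]; move: H1; rewrite cats0 => H1.
have [e2 [H2 _]] := run_mono (perm_dom pe') H1.
have [h _] := knuth_simulates (knuth_cat [::] f Hk); rewrite !cat0s in h.
have [e3 [/run_catE[e4 [N1 [N2 [EN H4 H5]]]] _]] := h _ _ _ (run_cat H H2).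
have l1 := run_columns_le sgs H4; have l2 := run_column_le sf H5.
move: l2 EN; rewrite (run_size H4) szf minnn Efull => l2 EN.
have E1 : N1 = fullcount (size e) (rcons gs g) by lia.
have E2 : N2 = size f by rewrite szf; lia.
move: H4 H5; rewrite E1 E2 => H4 H5.
have pg := run_columns_full sgs szg H4.
have [|_ D] := run_column_full sf _ H5; first by rewrite (run_size H4) szf.
by apply: dom_trans D; apply: perm_dom; rewrite perm_sym.
Qed.

(** * Sliding columns *)

(** Columns are treated as unordered lists here, hence the statements up to [perm_eq]. If no letter
    is [<= t], nothing is removed. *)
Definition bump_state (s : seq nat) (t : nat) : seq nat := t :: rem (pmax t s) s.

Lemma perm_pmax t s1 s2 : perm_eq s1 s2 -> pmax t s1 = pmax t s2.
Proof. by move=> p; apply: perm_big. Qed.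

Lemma perm_bump_state s1 s2 t :
  perm_eq s1 s2 -> perm_eq (bump_state s1 t) (bump_state s2 t).
Proof.
move=> p; rewrite /bump_state (perm_pmax t p) perm_cons.
have [m2|n2] := boolP (pmax t s2 \in s2); last first.
  by rewrite !rem_id ?(perm_mem p).
have m1 : pmax t s2 \in s1 by rewrite (perm_mem p).
have p1 := perm_to_rem m1; have p2 := perm_to_rem m2; perm_lia.
Qed.

Lemma perm_foldl_bump s1 s2 u :
  perm_eq s1 s2 -> perm_eq (foldl bump_state s1 u) (foldl bump_state s2 u).
Proof. by elim: u s1 s2 => //= t u IH s1 s2 /(perm_bump_state t); apply: IH. Qed.

Lemma sorted_ltn_cat_cons (A1 A2 : seq nat) x : sorted ltn (A1 ++ x :: A2) ->
  [/\ sorted ltn A1, sorted ltn A2, all (ltn^~ x) A1 & all (ltn x) A2].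
Proof.
rewrite !(sorted_pairwise ltn_trans) pairwise_cat /=.
move=> /and3P[H -> /andP[H2 ->]]; split=> //.
by apply/allP => a aA; apply: (allrelP H) (mem_head _ _).
Qed.

Lemma sorted_ltn_splice (A1 A2 : seq nat) t : sorted ltn A1 -> sorted ltn A2 ->
  all (ltn^~ t) A1 -> all (ltn t) A2 -> sorted ltn (A1 ++ t :: A2).
Proof.
rewrite !(sorted_pairwise ltn_trans) pairwise_cat /= => -> -> h1 h2.
rewrite h2 /= andbT; apply/allrelP => a b /(allP h1) /= at_.
by rewrite inE => /orP[/eqP->//|/(allP h2) /=]; apply: ltn_trans.
Qed.

Lemma sorted_ltn_split_pmax A t a : sorted ltn A -> a \in A -> a <= t ->
  exists A1 x A2, [/\ A = A1 ++ x :: A2, pmax t A = x, x <= t & all (ltn t) A2].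
Proof.
move=> sA aA a_t; have mA := pmax_mem aA a_t; have := pmax_le t A.
have ub := fun y => @pmax_ub t A y.
move: (pmax t A) mA ub sA => x /splitPr[A1 A2] ub sA xt; exists A1, x, A2; split=> //.
have [_ _ _ h] := sorted_ltn_cat_cons sA; apply/allP => y yA /=.
have := allP h y yA; have := ub y; rewrite mem_cat inE yA !orbT /=; lia.
Qed.

(** [t] moves left over each letter of [A1] by the second Knuth relation, the left neighbour of that
    letter being the middle value. *)
Lemma knuth_slide_lower A1 x t : sorted ltn A1 -> all (ltn^~ x) A1 -> x <= t ->
  knuth_eq (x :: rev A1 ++ [:: t]) (x :: t :: rev A1).
Proof.
elim/last_ind: A1 x => [|A a IH] x sA; first by move=> *; apply: knuth_refl.
rewrite all_rcons => /andP[/= ax _] xt; rewrite rev_rcons /=.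
move: sA; rewrite -cats1 => /sorted_ltn_cat_cons[sA _ hA _].
apply: (@knuth_trans _ (x :: a :: t :: rev A)).
  have := knuth_cat [:: x] [::] (IH a sA hA (leq_trans (ltnW ax) xt)).
  by rewrite /= !cats0.
by apply: knuth_step; apply: (@knuth2 [::] (rev A) a x t); rewrite ax.
Qed.

(** [x] moves left over each letter of [A2] by the first Knuth relation, the right neighbour of [x]
    being the middle value. *)
Lemma knuth_slide_upper A2 x t : sorted ltn A2 -> all (ltn t) A2 -> x <= t ->
  knuth_eq (rev A2 ++ [:: x; t]) (x :: rev A2 ++ [:: t]).
Proof.
elim: A2 t => [|b A IH] t sA; first by move=> *; apply: knuth_refl.
move=> /= /andP[tb _] xt; rewrite rev_cons -cats1 -!catA /=.
have [_ sA' _ hA] := @sorted_ltn_cat_cons [::] A b sA.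
apply: (@knuth_trans _ (rev A ++ [:: x; b; t])).
  by apply: knuth_sym; apply: knuth_step; apply: (@knuth1 (rev A) [::]); rewrite xt.
have := knuth_cat [::] [:: t] (IH b sA' hA (ltnW (leq_ltn_trans xt tb))).
by rewrite /= -!catA.
Qed.

(** [t] first passes the letters below [x]; then [x], the largest letter [<= t], leaves through
    those above [t]. *)
Lemma knuth_slide A1 x t A2 : sorted ltn (A1 ++ x :: A2) -> x <= t -> all (ltn t) A2 ->
  knuth_eq (rev (A1 ++ x :: A2) ++ [:: t]) (x :: rev (A1 ++ t :: A2)).
Proof.
move=> /sorted_ltn_cat_cons[s1 s2 h1 _] xt h2.
rewrite !rev_cat !rev_cons -!cats1 -!catA /=.
apply: (@knuth_trans _ (rev A2 ++ [:: x, t & rev A1])).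
  by have := knuth_cat (rev A2) [::] (knuth_slide_lower s1 h1 xt); rewrite !cats0.
by have := knuth_cat [::] (rev A1) (knuth_slide_upper s2 h2 xt); rewrite /= -!catA.
Qed.

Definition col_le (A B : seq nat) : Prop :=
  size B <= size A /\ forall p, p < size B -> nth 0 A p <= nth 0 B p.

(* Letters of [B] are moved to the left through [A] one at a time, largest
   first; each one expels a letter of [A]. *)
Lemma column_swap A B : sorted ltn A -> sorted ltn B -> col_le A B ->
  exists B' A',
    [/\ sorted ltn B', sorted ltn A', size B' = size B, size A' = size A &
        knuth_eq (rev A ++ rev B) (rev B' ++ rev A')] /\
    [/\ perm_eq A' (foldl bump_state A (rev B)), {subset B <= A'},
        forall a, a \in A -> all (ltn^~ a) B -> a \in A' &
        forall b, b \in B' -> b \in A /\ has (leq b) B].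
Proof.
(* The last two conclusions serve the induction: one keeps inserted letters of [B] in [A'], the
   other bounds the letters expelled later. *)
elim/last_ind: B A => [|B t IH] A sA sB [szAB leAB].
  by exists [::], A; rewrite cats0; split; split=> //; apply: knuth_refl.
rewrite size_rcons in szAB leAB.
have at_ : nth 0 A (size B) <= t.
  by have := leAB (size B) (ltnSn _); rewrite nth_rcons ltnn eqxx.
have [A1 [x [A2 [EA Ex xt h2]]]] := sorted_ltn_split_pmax sA (mem_nth 0 szAB) at_.
have [sB' _ hB _] : [/\ sorted ltn B, sorted ltn [::], all (ltn^~ t) B & true].
  by move: sB; rewrite -cats1 => /sorted_ltn_cat_cons[].
(* The entry of [A] in 0-based row [size B] is [<= t], so it cannot lie in [A2]. Thus the rows of
   [A] facing the remaining [B] stay untouched. *)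
have szB : size B <= size A1.
  rewrite leqNgt; apply/negP => lt.
  have lt2 : size B - (size A1).+1 < size A2.
    by move: szAB; rewrite EA size_cat /=; lia.
  have := allP h2 _ (mem_nth 0 lt2); move: at_.
  rewrite EA nth_cat ifF; last by lia.
  by rewrite -(subnSK lt) /=; lia.
rewrite EA in sA; have [s1 s2 h1 _] := sorted_ltn_cat_cons sA.
have h1t : all (ltn^~ t) A1 by apply/allP => y /(allP h1) /=; lia.
have sA' : sorted ltn (A1 ++ t :: A2) by apply: sorted_ltn_splice.
have [|B' [A' [[sB2 sA2 szB2 szA2 Hk] [pA sub keep from]]]] := IH _ sA' sB'.
  split; first by rewrite size_cat (leq_trans szB) // leq_addr.
  move=> p pB; have := leAB p (ltnW pB); rewrite nth_rcons pB EA !nth_cat.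
  by rewrite (leq_trans pB szB).
have noB b : t <= b -> ~ has (leq b) B.
  move=> tb /hasP[c /(allP hB) /= ct bc].
  by have := leq_trans tb bc; rewrite leqNgt ct.
exists (rcons B' x), A'; split; split=> //.
(* Letters expelled later lie weakly below some letter of [B], hence come from [A1] and are smaller
   than [x]. *)
- rewrite -cats1; apply: sorted_ltn_splice => //.
  apply/allP => b /from[]; rewrite mem_cat inE => /or3P[/(allP h1)//|/eqP->|].
    by move=> /(noB _ (leqnn t)).
  by move=> /(allP h2) /ltnW /noB.
- by rewrite !size_rcons szB2.
- by rewrite szA2 EA !size_cat.
- rewrite !rev_rcons /= -(cat1s x) -cat1s catA.
  apply: (@knuth_trans _ ([:: x] ++ rev (A1 ++ t :: A2) ++ rev B)).
    by have := knuth_cat [::] (rev B) (knuth_slide sA xt h2); rewrite EA.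
  by have := knuth_cat [:: x] [::] Hk; rewrite !cats0.
- rewrite rev_rcons /=; apply: perm_trans pA _; apply: perm_foldl_bump.
  have xA : x \in A by rewrite EA mem_cat mem_head orbT.
  have p1 := perm_to_rem xA; rewrite /bump_state Ex.
  have p2 : perm_eq A (x :: A1 ++ A2) by rewrite EA; perm_lia.
  perm_lia.
- move=> b; rewrite mem_rcons inE => /orP[/eqP->|/sub//].
  by apply: keep hB; rewrite mem_cat mem_head orbT.
- move=> a aA; rewrite all_rcons => /andP[/= ta aB]; apply: keep aB.
  move: aA; rewrite EA !mem_cat !inE => /or3P[->//|/eqP E|->]; last by rewrite !orbT.
  by move: ta; rewrite E ltnNge xt.
- move=> b; rewrite mem_rcons inE => /orP[/eqP->|/from[]].
    by rewrite EA mem_cat mem_head orbT has_rcons xt.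
  rewrite EA !mem_cat !inE has_rcons => h /[dup] hB2 ->; rewrite orbT; split=> //.
  case/or3P: h => [->//|/eqP E|->]; last by rewrite !orbT.
  by case: (noB b) => //; rewrite E.
Qed.

Fixpoint col_chain (A : seq nat) (Bs : seq (seq nat)) : Prop :=
  if Bs is B :: Bs' then [/\ col_le A B, sorted ltn B & col_chain B Bs'] else True.

Lemma sorted_ltn_leq s : sorted ltn s -> sorted leq s.
Proof. by apply: sub_sorted => x y; apply: ltnW. Qed.

Lemma subset_col_le A B : sorted ltn A -> sorted ltn B -> {subset B <= A} ->
  col_le A B.
Proof.
move=> sA sB sub; have uB := sorted_uniq ltn_trans ltnn sB.
have szBA := uniq_leq_size uB sub; split=> // p pB.
apply: dom_nth => //; try exact: sorted_ltn_leq.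
by move=> q; apply: count_le_subset.
Qed.

Lemma col_le_trans A B C : col_le A B -> col_le B C -> col_le A C.
Proof.
move=> [h1 h2] [h3 h4]; split=> [|p pC]; first exact: leq_trans h1.
by apply: leq_trans (h4 p pC); apply: h2; apply: leq_trans h3.
Qed.

(** Repeated two-column slides; this supplies frank words whose last column has the length of
    [A]. *)
Lemma column_move A Bs : sorted ltn A -> col_chain A Bs ->
  exists Bs' A',
    [/\ all (sorted ltn) Bs', sorted ltn A', map size Bs' = map size Bs,
        size A' = size A &
        knuth_eq (flatten (map rev (A :: Bs))) (flatten (map rev (rcons Bs' A')))] /\
    perm_eq A' (foldl bump_state A (flatten (map rev Bs))).
Proof.
elim: Bs A => [|B Bs IH] A sA /=.
  by exists [::], A; split=> //; split=> //; apply: knuth_refl.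
move=> [AB sB chain].
have [B' [A' [[sB' sA' szB' szA' Hk] [pA sub _ _]]]] := column_swap sA sB AB.
(* [A'] contains [B], so it lies entrywise below [B] and hence below the next column: the sliding
   can go on. *)
have chain' : col_chain A' Bs.
  have A'B := subset_col_le sA' sB sub.
  case: Bs {IH} chain => //= B2 Bs [BB2 sB2 ch]; split=> //.
  exact: col_le_trans A'B BB2.
have [Bs' [A2 [[H1 H2 H3 H4 H5] H6]]] := IH _ sA' chain'.
exists (B' :: Bs'), A2; split; [split=> //|].
- by rewrite /= sB' H1.
- by rewrite /= szB' H3.
- by rewrite H4.
- rewrite catA; apply: (knuth_trans (knuth_cat [::] _ Hk)); rewrite -catA /=.
  by have := knuth_cat (rev B') [::] H5; rewrite !cats0.
rewrite foldl_cat; apply: perm_trans H6 _; exact: perm_foldl_bump.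
Qed.

(** * Rows of a tableau as chains *)

Lemma run_skips e u : run e u 0 e.
Proof. by elim: u => [|x u IH]; [constructor | apply: run_skip]. Qed.

Lemma run_match X Y r e : all2 leq X Y -> perm_eq e (X ++ r) ->
  exists e', run e (rev Y) (size Y) e' /\ perm_eq e' (Y ++ r).
Proof.
elim/last_ind: Y X r e => [|Y y IH] X r e.
  by case: X => //= _ pe; exists e; split=> //; constructor.
case/lastP: X => [|X x]; first by case: Y {IH}.
rewrite all2E !size_rcons eqSS => /andP[/eqP szE]; rewrite zip_rcons // all_rcons.
move=> /andP[/= xy hall] pe; rewrite rev_rcons.
have [||e' [H1 H2]] := IH X (y :: r) (y :: X ++ r).
- by rewrite all2E szE eqxx.
- by perm_lia.
exists e'; split; last by rewrite cat_rcons.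
apply: (@run_hit _ _ _ _ _ x (X ++ r)) => //.
by rewrite cat_rcons in pe; perm_lia.
Qed.

(** The chains are the first [k] rows, so the bound is attained; [r] keeps the last letters of the
    rows that have already ended. *)
Lemma run_tableau k A Bs r e : col_chain A Bs -> size (take k A ++ r) = k ->
  perm_eq e (take k A ++ r) ->
  exists e', run e (flatten (map rev Bs)) (fullcount k Bs) e'.
Proof.
elim: Bs A r e => [|B Bs IH] A r e /=; first by exists e; constructor.
move=> [[szBA leAB] sB chain] szk pe; set b := minn k (size B).
have szb : size (take b B) = b by rewrite size_takel // /b geq_minr.
have [||e1 [H1 H2]] := @run_match (take b A) (take b B) (drop b (take k A) ++ r) e.
- rewrite all2E; have szA : size (take b A) = b.
    by rewrite size_takel // (leq_trans (geq_minr k (size B))).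
  rewrite szA szb eqxx /=; apply/(all_nthP (0, 0)) => i.
  rewrite size_zip szA szb minnn => ib.
  rewrite nth_zip ?szA ?szb //= !nth_take //; apply: leAB.
  exact: leq_trans ib (geq_minr _ _).
- rewrite catA (_ : take b A = take b (take k A)) ?cat_take_drop //.
  by rewrite take_takel // /b geq_minl.
have Eb : take k B = take b B.
  by rewrite /b /minn; case: ltnP => // h; rewrite take_size take_oversize.
have [||e' H3] := IH B (drop b (take k A) ++ r) e1 chain; rewrite ?Eb //.
  rewrite -(perm_size H2) (run_size H1) (perm_size pe) //.
exists e'; rewrite /fullcount /=; apply: run_cat H3.
(* The letters of [B] below row [b] are read first, and skipped. *)
rewrite -[in rev B](cat_take_drop b B) rev_cat.
by have := run_cat (run_skips e (rev (drop b B))) H1; rewrite szb.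
Qed.

(** * The greedy step *)

(* The cyclic shift of one greedy step, read off by a single left-to-right scan
   that carries the value [v] to be placed next. *)
Fixpoint cascade (v t : nat) (s : seq nat) : seq nat :=
  if s is x :: s' then
    if v < x <= t then v :: cascade x t s' else x :: cascade v t s'
  else [::].

Fixpoint cascade_pos (m v t : nat) (s : seq nat) : seq nat :=
  if s is x :: s' then
    if v < x <= t then m :: cascade_pos m.+1 x t s' else cascade_pos m.+1 v t s'
  else [::].

Fixpoint cascade_last (v t : nat) (s : seq nat) : nat :=
  if s is x :: s' then cascade_last (if v < x <= t then x else v) t s' else v.

Lemma size_cascade v t s : size (cascade v t s) = size s.
Proof. by elim: s v => //= x s IH v; case: ifP => _ /=; rewrite IH. Qed.

Lemma take_cascade m v t s : take m (cascade v t s) = cascade v t (take m s).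
Proof.
elim: s m v => [|x s IH] [|m] v //=; first by case: ifP.
by case: ifP => _ /=; rewrite IH.
Qed.

Lemma cascade_id t s : cascade t t s = s.
Proof. by elim: s => //= x s IH; rewrite IH ifF //; lia. Qed.

Lemma cascade_pos_nil m t s : cascade_pos m t t s = [::].
Proof. by elim: s m => //= x s IH m; rewrite IH ifF //; lia. Qed.

Lemma perm_cascade v t s : perm_eq (v :: s) (cascade_last v t s :: cascade v t s).
Proof.
elim: s v => //= x s IH v; case: ifP => _.
  by have := IH x => H; perm_lia.
by have := IH v => H; perm_lia.
Qed.

(** The carried value is the running maximum of the letters [<= t]; this is where [pmax] enters the
    greedy procedure. *)
Lemma cascade_lastE v t s : v <= t -> cascade_last v t s = pmax t (v :: s).
Proof.
elim: s v => [|x s IH] v vt /=; first by rewrite /pmax big_cons big_nil vt maxn0.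
have [/andP[vx xt]|h] := boolP (v < x <= t); rewrite IH // /pmax !big_cons vt.
  by rewrite xt; lia.
by case: ifP => // xt; lia.
Qed.

Lemma cascade_last_mem v t s : v <= t -> (v < t -> t \in s) -> cascade_last v t s = t.
Proof.
move=> vt ts; rewrite cascade_lastE //; apply: pmax_eq => //.
by move: vt; rewrite inE eq_sym leq_eqVlt => /orP[->//|/ts->]; rewrite orbT.
Qed.

(** If the left letter [x] becomes [v], the right one stays or becomes [x]. If [x < v] stays, the
    right one stays or becomes [v]. If [x > t], both stay. This preserves ascents inside the
    blocks. *)
Lemma cascade_increasing v t s q : uniq (v :: s) -> q.+1 < size s ->
  nth 0 s q < nth 0 s q.+1 -> nth 0 (cascade v t s) q < nth 0 (cascade v t s) q.+1.
Proof.
elim: s v q => // x s IH v [|q] /=.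
  rewrite inE negb_or => /andP[/andP[vx _] _]; case: s {IH} => //= y s _ xy.
  case: ifP => h; [case: ifP => h2 /= | case: ifP => h2 /=]; lia.
rewrite inE negb_or => /andP[/andP[vx vs] /andP[xs us]] sz lt.
by case: ifP => _ /=; apply: IH; rewrite //= ?xs ?vs ?us.
Qed.

Lemma greedy_chainE cj t s pre fuel v (pi := pre ++ s) : cj <= size pre ->
  (forall q, cj <= q < size pre -> ~~ (v < nth 0 pre q <= t)) ->
  t \in s -> v < t -> size s <= fuel ->
  greedy_chain fuel pi cj t v = Some (cascade_pos (size pre) v t s).
Proof.
rewrite {}/pi.
elim: s pre fuel v => // x s IH pre fuel v cpre old ts vt szf /=.
have := IH (rcons pre x); rewrite cat_rcons size_rcons => {}IH.
have old' v' : (v' = v \/ v < x <= t /\ v' = x) -> ~~ (v' < x <= t) ->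
    forall q, cj <= q < (size pre).+1 -> ~~ (v' < nth 0 (rcons pre x) q <= t).
  move=> Hv hx q /andP[cq]; rewrite ltnS leq_eqVlt => /orP[/eqP->|qpre].
    by rewrite nth_rcons ltnn eqxx.
  rewrite nth_rcons qpre; have := old q; rewrite cq qpre => /(_ isT).
  case: Hv => [->//|[/andP[vx _] ->]]; apply: contra => /andP[xn ->].
  by rewrite (ltn_trans vx xn).
case: ifP => [h|/negbT h]; last first.
  have ts' : t \in s.
    by move: ts h; rewrite inE => /orP[/eqP <-|//]; rewrite vt leqnn.
  apply: IH => //; first exact: leqW.
    by apply: old' => //; left.
  exact: ltnW.
case: fuel szf => // fuel szf /=.
have -> : [seq q <- iota 0 (size (pre ++ x :: s)) | (cj <= q) &&
    (v < nth 0 (pre ++ x :: s) q) && (nth 0 (pre ++ x :: s) q <= t)] =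
    size pre :: [seq q <- iota (size pre).+1 (size s) | (cj <= q) &&
    (v < nth 0 (pre ++ x :: s) q) && (nth 0 (pre ++ x :: s) q <= t)].
  rewrite size_cat iotaD filter_cat add0n /= nth_cat ltnn subnn /= cpre /= h.
  rewrite (_ : [seq q <- iota 0 (size pre) | _] = [::]) //.
  apply/eqP; rewrite -[_ == _]negbK -has_filter; apply/hasPn => q.
  rewrite mem_iota add0n => /= qpre; rewrite nth_cat qpre.
  by have [cq|//] := leqP cj q; have := old q; rewrite cq qpre; exact.
rewrite nth_cat ltnn subnn /=; case: eqP => [->|/eqP xt].
  by rewrite cascade_pos_nil.
move: ts; rewrite inE eq_sym (negbTE xt) /= => ts; rewrite IH ?leqW //.
  by apply: old'; [right | rewrite ltnn].
by rewrite ltn_neqAle xt; case/andP: h.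
Qed.

(** [pi] is the permutation before the step, from which all values are read while the list is being
    overwritten. *)
Lemma assign_cascade t s pre v pi : drop (size pre) pi = s ->
  assign (pre ++ s) (cascade_pos (size pre) v t s)
    (v :: map (nth 0 pi) (cascade_pos (size pre) v t s)) = pre ++ cascade v t s.
Proof.
elim: s pre v => // x s IH pre v E /=.
have Ex : nth 0 pi (size pre) = x by rewrite -[size pre]addn0 -nth_drop E.
have Es : drop (size pre).+1 pi = s by rewrite -add1n -drop_drop E /= drop0.
case: ifP => h; last first.
  by have := IH (rcons pre x) v; rewrite size_rcons !cat_rcons; apply.
rewrite /assign /= Ex.
have -> : set_nth 0 (pre ++ x :: s) (size pre) v = rcons pre v ++ s.
  by rewrite cat_rcons; elim: (pre) => //= y p ->.
by have := IH (rcons pre v) x; rewrite size_rcons -cat_rcons; apply.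
Qed.

Lemma last_cascade_pos t s pi m v : drop m pi = s ->
  last v (map (nth 0 pi) (cascade_pos m v t s)) = cascade_last v t s.
Proof.
elim: s m v => // x s IH m v E /=.
have Ex : nth 0 pi m = x by rewrite -[m]addn0 -nth_drop E.
have Es : drop m.+1 pi = s by rewrite -add1n -drop_drop E /= drop0.
by case: ifP => h /=; rewrite ?Ex IH.
Qed.

Lemma zip_belast (l vs : seq nat) v : size vs = size l ->
  zip l (belast v vs) = zip l (v :: vs).
Proof.
elim: l v vs => [|a l IH] v [|b vs] // [sz].
by rewrite [belast _ _]/=; congr cons; apply: IH.
Qed.

(** The first [c_j] entries are [X1 ++ v :: X2], so only [s] is scanned. The case [v = t] is
    included, as the cascade is then the identity. *)
Lemma greedy_stepE n lam T j v t (X1 X2 s : seq nat) :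
  entry T j (size X1).+1 = t -> entry T j.-1 (size X1).+1 = v ->
  collen lam j = size X1 + (size X2).+1 -> v <= t -> (v < t -> t \in s) ->
  size s <= n ->
  greedy_step n lam T (X1 ++ v :: X2 ++ s) (j, (size X1).+1) =
  X1 ++ t :: X2 ++ cascade v t s.
Proof.
move=> Et Ev Ec vt ts szs; rewrite /greedy_step /= Et Ev.
case: eqP => [->|/eqP vnt]; first by rewrite cascade_id.
have {}vt : v < t by rewrite ltn_neqAle vnt.
set pre := X1 ++ v :: X2.
have szpre : size pre = size X1 + (size X2).+1 by rewrite size_cat.
have Epi : X1 ++ v :: X2 ++ s = pre ++ s by rewrite /pre -catA.
have Ev0 : nth 0 (pre ++ s) (size X1) = v by rewrite -Epi nth_cat ltnn subnn.
rewrite Epi Ev0 greedy_chainE ?ts ?szpre ?Ec //; last by move=> q; lia.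
rewrite -szpre; set l := cascade_pos _ _ _ _.
set vs := map (nth 0 (pre ++ s)) l.
(* The rotation gives the last value, [t], to row [i] and the preceding chain value to every other
   position. *)
rewrite (lastI v vs) rotr1_rcons /assign /= zip_belast ?size_map //.
have Edrop : drop (size pre) (pre ++ s) = s by rewrite drop_size_cat.
rewrite (last_cascade_pos t v Edrop) cascade_last_mem ?ts ?(ltnW vt) //.
have -> : set_nth 0 (pre ++ s) (size X1) t = (X1 ++ t :: X2) ++ s.
  by rewrite /pre -!catA; elim: (X1) => //= y p ->.
have := @assign_cascade t s (X1 ++ t :: X2) v (pre ++ s).
have -> : size (X1 ++ t :: X2) = size pre by rewrite szpre size_cat.
by move=> /(_ Edrop); rewrite -/l -/vs /assign => ->; rewrite -catA.
Qed.

(** As [A] lies below [a] and [Y] above [b], the largest letter [<= b] is the value the cascade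
    still carries at the end of the prefix; this value drops out and [b] comes in, as in bumping. *)
Lemma perm_cascade_prefix (A Y s : seq nat) a b :
  all (ltn^~ a) A -> a <= b -> all (ltn b) Y ->
  perm_eq (A ++ b :: Y ++ cascade a b s) (bump_state (A ++ a :: Y ++ s) b).
Proof.
move=> hA ab hY; rewrite /bump_state; have := perm_cascade a b s.
rewrite cascade_lastE //; have mas := pmax_mem (mem_head a s) ab.
have -> : pmax b (A ++ a :: Y ++ s) = pmax b (a :: s).
  apply: pmax_eq.
  - move: mas; rewrite mem_cat !inE mem_cat => /orP[->|->]; rewrite ?orbT //.
  - exact: pmax_le.
  - move=> y; rewrite mem_cat inE mem_cat => /or4P[/(allP hA) /= ya _|yE yb|yY yb|ys yb].
    + by apply: leq_trans (ltnW ya) _; apply: pmax_ub; rewrite ?mem_head.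
    + by apply: pmax_ub; rewrite // inE yE.
    + by have := allP hY _ yY => /=; rewrite ltnNge yb.
    + by apply: pmax_ub; rewrite // inE ys orbT.
have mP : pmax b (a :: s) \in A ++ a :: Y ++ s.
  by move: mas; rewrite mem_cat !inE mem_cat => /orP[->|->]; rewrite ?orbT.
have p1 := perm_to_rem mP => p2; move: (pmax _ _) p1 p2 => m p1 p2.
apply/permP => P; move/permP/(_ P): p1; move/permP/(_ P): p2.
by rewrite /= !count_cat /= !count_cat; clear; lia.
Qed.

(** Rows are treated from the bottom: [A] and [B] are the rows still to come, [Y] the new entries
    already in place. All [m] are needed, because each longer column follows its own prefix. *)
Lemma greedy_column n lam T j (A B Y s : seq nat) :
  let c := size A + size Y in
  let pi := A ++ Y ++ s in
  let pi' := foldl (greedy_step n lam T) pi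
               [seq (j, i) | i <- rev (iota 1 (size A))] in
  size A = size B -> collen lam j = c ->
  (forall i, i < size A -> entry T j.-1 i.+1 = nth 0 A i) ->
  (forall i, i < size A -> entry T j i.+1 = nth 0 B i) ->
  (forall i, i < size A -> nth 0 A i <= nth 0 B i) ->
  sorted ltn A -> sorted ltn (B ++ Y) ->
  perm_eq pi (iota 1 n) -> {subset B <= iota 1 n} ->
  exists s', [/\ pi' = B ++ Y ++ s', perm_eq pi' (iota 1 n), size s' = size s,
    forall m, perm_eq (take (c + m) pi') (foldl bump_state (take (c + m) pi) (rev B)) &
    forall q, q.+1 < size s -> nth 0 s q < nth 0 s q.+1 ->
      nth 0 s' q < nth 0 s' q.+1].
Proof.
elim/last_ind: A B Y s => [|A a IH] B Y s /=.
  by case: B => // _ *; exists s; split.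
case/lastP: B => [|B b]; first by rewrite size_rcons.
rewrite !size_rcons => -[szAB] Ec EA EB leAB sA sB pN subB.
have Ea : entry T j.-1 (size A).+1 = a.
  by rewrite EA // nth_rcons ltnn eqxx.
have Eb : entry T j (size A).+1 = b.
  by rewrite EB // nth_rcons szAB ltnn eqxx.
have ab : a <= b by rewrite -Ea -Eb EA // EB // leAB.
have [sA' _ hA _] : [/\ sorted ltn A, sorted ltn [::], all (ltn^~ a) A & true].
  by move: sA; rewrite -cats1 => /sorted_ltn_cat_cons[].
have [sB' sY hB hY] : [/\ sorted ltn B, sorted ltn Y, all (ltn^~ b) B & all (ltn b) Y].
  by move: sB; rewrite cat_rcons => /sorted_ltn_cat_cons.
move: pN; rewrite cat_rcons => pN.
have uN : uniq (A ++ a :: Y ++ s) by rewrite (perm_uniq pN) iota_uniq.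
(* Letters of [A] are below [a] and those of [Y] above [b], so [b] sits after position [c_j] and the
   chain reaches it. *)
have bs : a < b -> b \in s.
  move=> lt; have : b \in A ++ a :: Y ++ s.
    by rewrite (perm_mem pN); apply: subB; rewrite mem_rcons mem_head.
  rewrite mem_cat inE mem_cat => /or4P[/(allP hA) /= ba|/eqP E|/(allP hY) /=|//].
  - by have := ltn_trans lt ba; rewrite ltnn.
  - by move: lt; rewrite E ltnn.
  - by rewrite ltnn.
have szs : size s <= n.
  have := perm_size pN; rewrite size_iota !size_cat /= size_cat => <-.
  by clear; lia.
have -> : rev (iota 1 (size A).+1) = (size A).+1 :: rev (iota 1 (size A)).
  by rewrite -{1}(addn1 (size A)) iotaD rev_cat add1n.
rewrite /= (@greedy_stepE _ _ _ _ a b) //; last by rewrite Ec addSnnS.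
have pb := perm_cascade a b s; rewrite cascade_last_mem // in pb.
have pN' : perm_eq (A ++ (b :: Y) ++ cascade a b s) (iota 1 n).
  by apply: perm_trans pN; perm_lia.
have [||||||||s' [E1 E2 E3 E4 E5]] := IH B (b :: Y) (cascade a b s) szAB.
- by rewrite Ec /= addnS.
- by move=> i iA; rewrite EA ?ltnS 1?ltnW // nth_rcons iA.
- by move=> i iA; rewrite EB ?ltnS 1?ltnW // nth_rcons -szAB iA.
- move=> i iA; have := leAB i (ltnW iA).
  by rewrite !nth_rcons -szAB iA.
- by [].
- by rewrite -cat_rcons.
- by [].
- by move=> y yB; apply: subB; rewrite mem_rcons inE yB orbT.
move: E1 E2 E4; rewrite /= => E1 E2 E4.
exists s'; split=> //.
- by rewrite E1 cat_rcons.
- by rewrite E3 size_cascade.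
- move=> m; have := E4 m; rewrite addnS -addSn.
  move=> /perm_trans; apply; rewrite rev_rcons /=; apply: perm_foldl_bump.
  have tk (x : nat) (u : seq nat) :
      take ((size A).+1 + size Y + m) (A ++ x :: Y ++ u) = A ++ x :: Y ++ take m u.
    rewrite -cat_rcons catA take_cat size_cat size_rcons ifF; last by clear; lia.
    by rewrite addKn -catA cat_rcons.
  by rewrite !tk take_cascade; apply: perm_cascade_prefix.
- move=> q qs lt; apply: E5; rewrite ?size_cascade //; apply: cascade_increasing => //.
  apply: subseq_uniq uN; apply: (@cat_subseq _ [::]); first exact: sub0seq.
  by rewrite /= eqxx suffix_subseq.
Qed.

(** * Semistandard tableaux *)

Lemma leq_collen lam j k : j <= k -> collen lam k <= collen lam j.
Proof. by move=> jk; apply: sub_count => l /=; apply: leq_trans. Qed.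

Lemma sorted_nth_ltn s i : sorted ltn s -> i.+1 < size s ->
  nth 0 s i < nth 0 s i.+1.
Proof. by move=> /(sortedP 0) h; apply: h. Qed.

Lemma col_chainP A Bs :
  (forall i, i < size Bs -> col_le (nth [::] (A :: Bs) i) (nth [::] Bs i)) ->
  all (sorted ltn) Bs -> col_chain A Bs.
Proof.
elim: Bs A => //= B Bs IH A h /andP[sB sBs]; split=> //; first exact: (h 0).
by apply: IH => // i hi; apply: (h i.+1).
Qed.

Lemma fullcount_perm k fs gs : perm_eq (map size fs) (map size gs) ->
  fullcount k fs = fullcount k gs.
Proof.
move=> /(perm_map (minn k)); rewrite -!map_comp => p.
by rewrite /fullcount !sumnE; apply: perm_big.
Qed.

Section SSYT.

Variables (n : nat) (lam : seq nat) (T : seq (seq nat)).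
Hypothesis ssT : is_SSYT n lam T.

Lemma size_SSYT : size T = lam1 lam.
Proof. by case: ssT => [[]]. Qed.

Lemma size_column j : 0 < j <= lam1 lam -> size (column T j) = collen lam j.
Proof. by case: ssT => [[_ h] _]; apply: h. Qed.

Lemma sorted_column j : 0 < j <= lam1 lam -> sorted ltn (column T j).
Proof.
move=> hj; apply/(sortedP 0) => i; rewrite size_column // => hi.
by case: ssT => [_ [_ [h _]]]; apply: (h j i.+1 hj).
Qed.

Lemma column_sub j : 0 < j <= lam1 lam -> {subset column T j <= iota 1 n}.
Proof.
move=> hj x /(nthP 0)[i]; rewrite size_column // => hi <-.
case: ssT => [_ [h _]]; have := h j i.+1 hj hi.
by rewrite mem_iota add1n ltnS.
Qed.

Lemma column_col_le j : 0 < j < lam1 lam -> col_le (column T j) (column T j.+1).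
Proof.
move=> /andP[j0 jl]; split=> [|p].
  by rewrite !size_column ?leq_collen ?j0 ?(ltnW jl) //; lia.
rewrite size_column ?jl // => hp; case: ssT => [_ [_ [_ h]]].
by apply: (h j p.+1); rewrite ?j0.
Qed.

Lemma perm_pi_init : 0 < lam1 lam -> perm_eq (pi_init n T) (iota 1 n).
Proof.
move=> l0; have h1 : 0 < 1 <= lam1 lam by [].
have u1 := sorted_uniq ltn_trans ltnn (sorted_column h1).
apply: uniq_perm; rewrite ?iota_uniq //.
  rewrite cat_uniq u1 filter_uniq ?iota_uniq // andbT /=.
  by apply/hasPn => x; rewrite mem_filter => /andP[].
move=> x; rewrite mem_cat mem_filter.
by have [/(column_sub h1) ->|] := boolP (x \in column T 1).
Qed.

(** The invariant once columns 2 to [m.+1] are processed. Each new column heads the permutation and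
    adds its letters to the bumping word of every earlier column. *)
Lemma greedy_columns m : m < lam1 lam ->
  let pi := foldl (greedy_step n lam T) (pi_init n T)
    (flatten [seq [seq (j, i) | i <- rev (iota 1 (collen lam j))]
             | j <- iota 2 m]) in
  exists s, [/\ pi = column T m.+1 ++ s, perm_eq pi (iota 1 n),
    forall q, q.+1 < size s -> ~~ is_collen lam (collen lam m.+1 + q.+1) ->
      nth 0 s q < nth 0 s q.+1 &
    forall j, 0 < j <= m.+1 -> perm_eq (take (collen lam j) pi)
      (foldl bump_state (column T j)
         (flatten [seq rev (column T l) | l <- iota j.+1 (m.+1 - j)]))].
Proof.
elim: m => [|m IH] ml; cbv zeta.
  exists [seq x <- iota 1 n | x \notin column T 1]; split=> //.
  - exact: perm_pi_init.
  - move=> q qs _; apply: sorted_nth_ltn => //.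
    by apply: sorted_filter; [exact: ltn_trans | exact: iota_ltn_sorted].
  - case=> [|[|j]] //= _.
    by rewrite -size_column // take_size_cat.
have [s [E pE inc sets]] := IH (ltnW ml).
have h1 : 0 < m.+1 <= lam1 lam by exact: ltnW.
have h2 : 0 < m.+2 <= lam1 lam by [].
have [sz12 le12] : col_le (column T m.+1) (column T m.+2) by apply: column_col_le.
set c := collen lam m.+2; have szB : size (column T m.+2) = c by rewrite size_column.
have szA : size (take c (column T m.+1)) = c by rewrite size_takel // -szB.
set pi := foldl _ _ _ in E pE sets.
(* The rows of the old column below row [c] join the part that is scanned. *)
have Epi : pi = take c (column T m.+1) ++ [::] ++ (drop c (column T m.+1) ++ s).
  by rewrite E /= catA cat_take_drop.
have -> : iota 2 m.+1 = rcons (iota 2 m) m.+2.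
  by rewrite -cats1 -{1}(addn1 m) iotaD.
rewrite map_rcons flatten_rcons foldl_cat -/pi -/c.
have [|||||||||s' [E1 E2 E3 E4 E5]] := @greedy_column n lam T m.+2
  (take c (column T m.+1)) (column T m.+2) [::] (drop c (column T m.+1) ++ s).
- by rewrite szA szB.
- by rewrite szA addn0.
- by move=> i; rewrite szA => ic; rewrite nth_take.
- by [].
- by move=> i; rewrite szA => ic; rewrite nth_take // le12 // szB.
- by apply: take_sorted; apply: sorted_column.
- by rewrite cats0; apply: sorted_column.
- by rewrite -Epi.
- exact: column_sub.
move: E1 E2 E4; rewrite -Epi szA /= => E1 E2 E4.
exists s'; split=> //.
- move=> q; rewrite E3 => qs nc; apply: E5 => //.
  have sd : sorted ltn (drop c (column T m.+1)) by apply: drop_sorted; apply: sorted_column.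
  have szd : size (drop c (column T m.+1)) + c = collen lam m.+1.
    by rewrite size_drop size_column // subnK // leq_collen.
  (* The ascent lies in the rest of the old column, in [s], or across their border; the border is at
     a column length and so is excluded. *)
  rewrite !nth_cat; case: (ltngtP q.+1 (size (drop c (column T m.+1)))) => h.
  + exact: sorted_nth_ltn.
  + rewrite subSn //; apply: inc.
      by move: qs; rewrite size_cat; lia.
    by apply: contra nc; rewrite -szd (_ : _ + _ = c + q.+1) //; lia.
  + case/negP: nc; rewrite h addnC szd; apply/hasP; exists m.+1 => //.
    by rewrite mem_iota; lia.
- move=> j /andP[j0]; rewrite leq_eqVlt => /orP[/eqP->|jm].
    by rewrite subnn /= -/c E1 -szB take_size_cat.
  have [k Ek] : exists k, collen lam j = c + k.
    by exists (collen lam j - c); rewrite subnKC // leq_collen // ltnW.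
  have := E4 k; rewrite addn0 -Ek => /perm_trans; apply.
  have -> : iota j.+1 (m.+2 - j) = rcons (iota j.+1 (m.+1 - j)) m.+2.
    rewrite subSn // -cats1 -{1}(addn1 (_ - j)) iotaD; congr (_ ++ [:: _]).
    by rewrite addSn subnKC.
  rewrite map_rcons flatten_rcons foldl_cat; apply: perm_foldl_bump.
  by apply: sets; rewrite j0.
Qed.

Lemma piT_facts : 0 < lam1 lam ->
  [/\ perm_eq (piT n lam T) (iota 1 n),
    forall p, 0 < p < n -> ~~ is_collen lam p ->
      nth 0 (piT n lam T) p.-1 < nth 0 (piT n lam T) p &
    forall j, 0 < j <= lam1 lam -> perm_eq (take (collen lam j) (piT n lam T))
      (foldl bump_state (column T j)
        (flatten [seq rev (column T l) | l <- iota j.+1 (lam1 lam - j)]))].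
Proof.
move=> l0; have [|s [E pE inc sets]] := @greedy_columns (lam1 lam).-1; first by lia.
rewrite -/(greedy_locs lam) -/(piT n lam T) prednK // in E pE inc sets.
split=> // p /andP[p0 pn] nc.
have hl : 0 < lam1 lam <= lam1 lam by rewrite l0 /=.
have szC := size_column hl.
have := perm_size pE; rewrite size_iota E size_cat szC => szs.
rewrite !nth_cat szC; case: (ltngtP p (collen lam (lam1 lam))) => h.
- rewrite (_ : p.-1 < _); last by lia.
  rewrite -{2}(prednK p0); apply: sorted_nth_ltn; first exact: sorted_column.
  by rewrite prednK // szC.
- rewrite ifF; last by lia.
  have -> : p - collen lam (lam1 lam) = (p.-1 - collen lam (lam1 lam)).+1 by lia.
  apply: inc; first by rewrite -(ltn_add2l (collen lam (lam1 lam))) szs; lia.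
  by rewrite (_ : _ + _ = p) //; lia.
- case/negP: nc; rewrite h; apply/hasP; exists (lam1 lam) => //.
  by rewrite mem_iota; lia.
Qed.

(** * Frank words of a tableau *)

Lemma drop_columns j : drop j T = [seq column T l | l <- iota j.+1 (lam1 lam - j)].
Proof.
apply: (@eq_from_nth _ [::]); first by rewrite size_drop size_map size_iota size_SSYT.
move=> i; rewrite size_drop size_SSYT => hi.
by rewrite nth_drop (nth_map 0) ?size_iota // nth_iota.
Qed.

Lemma all_sorted_SSYT : all (sorted ltn) T.
Proof.
apply/(all_nthP [::]) => i hi; apply: (@sorted_column i.+1).
by rewrite /= -size_SSYT.
Qed.

Lemma col_chain_drop j : 0 < j <= lam1 lam -> col_chain (column T j) (drop j T).
Proof.
move=> /andP[j0 jl]; apply: col_chainP; last first.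
  by apply/allP => C /mem_drop; apply: (allP all_sorted_SSYT).
move=> i; rewrite size_drop size_SSYT => hi; rewrite nth_drop.
have -> : nth [::] (column T j :: drop j T) i = column T (j + i).
  case: i hi => [|i] hi; first by rewrite addn0.
  by rewrite /= nth_drop addnS.
by apply: (@column_col_le (j + i)); lia.
Qed.

Lemma map_size_SSYT : map size T = [seq collen lam j | j <- iota 1 (lam1 lam)].
Proof.
rewrite -{1}(drop0 T) drop_columns subn0 -map_comp; apply/eq_in_map => j.
by rewrite mem_iota add1n ltnS => hj /=; apply: size_column.
Qed.

Lemma run_SSYT k : exists e', run (nseq k 0) (colword T) (fullcount k T) e'.
Proof.
(* The chains start in a fictitious column of zeros, long enough both for [k] rows and for the first
   column of [T]. *)
apply: (@run_tableau k (nseq (k + size (head [::] T)) 0) T [::]).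
- case ET: (T) => [|C Cs] //=; have := @col_chain_drop 1; rewrite ET /= drop0 => h.
  have l0 : 0 < 1 <= lam1 lam by rewrite -size_SSYT ET.
  split; [split | | exact: h].
  + by rewrite size_nseq leq_addl.
  + by move=> p pC; rewrite nth_nseq; case: ifP.
  + by have := sorted_column l0; rewrite ET.
- by rewrite cats0 size_takel // size_nseq leq_addr.
- rewrite cats0 -{2}[k](@minn_idPl k (k + size (head [::] T)) _) ?leq_addr //.
  by rewrite take_nseq ?leq_addr // (minn_idPl _) ?leq_addr.
Qed.

(** Domination holds in both directions by [last_column_dom]; thus the right key is well defined. *)
Lemma frank_last_unique fs gs : frank_fact lam T fs -> frank_fact lam T gs ->
  size (last [::] fs) = size (last [::] gs) -> last [::] fs = last [::] gs.
Proof.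
move=> [sf [pf kf]] [sg [pg kg]].
case/lastP: fs sf pf kf => [|fs f] sf pf kf.
  by move=> /esym/size0nil ->.
case/lastP: gs sg pg kg => [|gs g] sg pg kg; first by move=> /size0nil ->.
rewrite !last_rcons => szfg.
have main fs1 f1 gs1 g1 : all (sorted gtn) (rcons fs1 f1) ->
    all (sorted gtn) (rcons gs1 g1) ->
    perm_eq (map size (rcons fs1 f1)) [seq collen lam j | j <- iota 1 (lam1 lam)] ->
    perm_eq (map size (rcons gs1 g1)) [seq collen lam j | j <- iota 1 (lam1 lam)] ->
    knuth_eq (flatten (rcons fs1 f1)) (colword T) ->
    knuth_eq (flatten (rcons gs1 g1)) (colword T) -> size f1 = size g1 -> dom g1 f1.
  move=> sf1 sg1 pf1 pg1 kf1 kg1 sz1; rewrite -map_size_SSYT in pf1 pg1.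
  (* The rows of [T] give a maximal run, which Knuth equivalence carries to the frank word. *)
  have [e' H] := run_SSYT (size f1); have [_ sim] := knuth_simulates kf1.
  have [e1 [H1 _]] := sim _ _ _ H.
  apply: (@last_column_dom (nseq (size f1) 0) fs1 f1 gs1 g1 e1) => //;
    rewrite ?size_nseq //.
  - by apply: fullcount_perm; rewrite (permPl pf1) perm_sym.
  - by apply: knuth_trans kf1 _; apply: knuth_sym.
  - by rewrite (fullcount_perm _ pf1).
have rs (s : seq nat) : sorted gtn s -> sorted ltn (rev s) by rewrite rev_sorted.
have sf' : sorted gtn f by move: sf; rewrite all_rcons => /andP[].
have sg' : sorted gtn g by move: sg; rewrite all_rcons => /andP[].
have dr (s t : seq nat) : dom s t -> dom (rev s) (rev t).
  by move=> h q; rewrite !count_rev.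
apply: (can_inj (@revK _)); apply: dom_antisym_sorted; rewrite ?rs ?size_rev //.
  by apply/dr/(main gs g fs f).
by apply/dr/(main fs f gs g).
Qed.

(** The columns before [j] stay in place, and column [j] moves past all later ones. *)
Lemma frank_last_exists j : 0 < lam1 lam -> 0 < j <= lam1 lam -> exists fs,
  frank_fact lam T fs /\
  rev (last [::] fs) = sort leq (take (collen lam j) (piT n lam T)).
Proof.
move=> l0 hj; have [_ _ /(_ j hj) sets] := piT_facts l0.
have [Bs [A [[sBs sA szBs szA Hk] pA]]] :=
  column_move (sorted_column hj) (col_chain_drop hj).
have ET : T = take j.-1 T ++ column T j :: drop j T.
  rewrite -{1}(cat_take_drop j.-1 T) (drop_nth [::]); last by rewrite size_SSYT; lia.
  by rewrite prednK //; case/andP: hj.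
exists (map rev (take j.-1 T) ++ map rev (rcons Bs A)); split; last first.
  rewrite map_rcons last_cat last_rcons revK.
  have sA' : sorted leq A by apply: sorted_ltn_leq.
  rewrite -(sorted_sort leq_trans sA'); apply/(perm_sortP leq_total leq_trans anti_leq).
  apply: (perm_trans pA); rewrite perm_sym drop_columns -map_comp; exact: sets.
split; [|split].
- rewrite -map_cat all_map; apply/allP => C; rewrite mem_cat /= rev_sorted.
  case/orP=> [/mem_take/(allP all_sorted_SSYT)//|].
  by rewrite mem_rcons inE => /orP[/eqP->//|/(allP sBs)].
- rewrite -map_size_SSYT -map_cat -map_comp.
  have -> : map (size \o rev) (take j.-1 T ++ rcons Bs A) =
      map size (take j.-1 T ++ rcons Bs A).
    by apply: eq_map => C; rewrite /= size_rev.
  rewrite [in X in perm_eq _ (map size X)]ET !map_cat perm_cat2l map_rcons szBs szA /=.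
  by rewrite -cats1 perm_catC.
rewrite flatten_cat /colword [in X in knuth_eq _ X]ET map_cat flatten_cat.
apply: knuth_sym; have := knuth_cat (flatten (map rev (take j.-1 T))) [::] Hk.
by rewrite !cats0.
Qed.

End SSYT.

(** * Comparison of keys and the Bruhat order *)

Lemma lam1_gt0 n lam : is_partition n lam -> lam != nseq n 0 -> 0 < lam1 lam.
Proof.
move=> [<- sl]; apply: contraR; rewrite -eqn0Ngt /lam1.
case: lam sl => //= a l pl /eqP a0; rewrite a0 /= in pl *.
have /allP h : all (geq 0) l.
  by apply: order_path_min pl => x y z /= h1 h2; apply: leq_trans h2 h1.
by rewrite eqseq_cons eqxx; apply/eqP/all_pred1P/allP => x /h; rewrite /= leqn0.
Qed.

Lemma entry_Ykey lam phi j i : 0 < j <= lam1 lam ->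
  entry (Ykey lam phi) j i = nth 0 (sort leq (take (collen lam j) phi)) i.-1.
Proof.
move=> /andP[j0 jl]; rewrite /entry /column /Ykey (nth_map 0); last first.
  by rewrite size_iota; lia.
by rewrite nth_iota ?add1n ?prednK //; lia.
Qed.

Theorem theorem6p2 (n : nat) (lam : seq nat) (T : seq (seq nat)) (w : seq nat) :
  0 < n ->
  is_partition n lam ->
  last 0 lam = 0 ->
  lam != nseq n 0 ->
  is_SSYT n lam T ->
  in_SnLam n lam w ->
  (in_D n lam w T <-> bruhat_le (piT n lam T) w).
Proof.
move=> _ plam _ lam0 ssT [pw _].
have l0 := lam1_gt0 plam lam0; have [ppi inc _] := piT_facts ssT l0.
have szpi : size (piT n lam T) = n by rewrite (perm_size ppi) size_iota.
have szw : size w = n by rewrite (perm_size pw) size_iota.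
have cn j : collen lam j <= n by case: plam => <- _; apply: count_size.
have size_sort_take u j : size u = n ->
    size (sort leq (take (collen lam j) u)) = collen lam j.
  by move=> szu; rewrite size_sort size_takel // szu.
have sortP u v j : size u = n -> size v = n ->
    dom (take (collen lam j) u) (take (collen lam j) v) <->
    forall p, p < collen lam j -> nth 0 (sort leq (take (collen lam j) u)) p <=
      nth 0 (sort leq (take (collen lam j) v)) p.
  move=> szu szv; split=> [D p pc|h].
    apply: dom_nth; rewrite ?sort_sorted ?size_sort_take //; try exact: leq_total.
    by move=> q; have := D q; rewrite !count_sort.
  have D : dom (sort leq (take (collen lam j) u)) (sort leq (take (collen lam j) v)).
    by apply: nth_dom; rewrite !size_sort_take.
  by move=> q; have := D q; rewrite !count_sort.
split=> [[_ [K [[szK keyK] leK]]]|le_pi].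
  apply: dom_bruhat_le; first by rewrite (permPl ppi) perm_sym.
  (* Keys compare only prefixes whose length is a column length; the ascents of [piT] inside the
     blocks supply the others. *)
  apply: (@dom_take_blocks (is_collen lam)) => //.
  - by rewrite szpi szw.
  - move=> p _ /hasP[j]; rewrite mem_iota add1n ltnS => hj /eqP <-.
    apply/sortP => // p' pc; have := leK j p'.+1 hj pc.
    rewrite entry_Ykey // /entry.
    have [fs [Hfs [szfs ->]]] := keyK j hj.
    have [gs [Hgs Egs]] := frank_last_exists ssT l0 hj.
    (* The frank word behind [K] may be replaced by the one obtained by sliding, whose last column
       is read off [piT]. *)
    rewrite (frank_last_unique ssT Hfs Hgs) ?Egs //.
    by rewrite szfs -(size_rev (last [::] gs)) Egs size_sort_take.
  - by rewrite (permPl ppi) perm_sym.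
  - by move=> p; rewrite szpi; apply: inc.
split=> //; exists (Ykey lam (piT n lam T)); split; last first.
  move=> j i hj /andP[i0 ic]; rewrite !entry_Ykey //.
  have /sortP h := bruhat_le_dom (collen lam j) le_pi.
  by apply: h => //; rewrite prednK.
split=> [|j hj]; first by rewrite size_map size_iota.
have [fs [Hfs Efs]] := frank_last_exists ssT l0 hj.
exists fs; split=> //; split.
  by rewrite -(size_rev (last [::] fs)) Efs size_sort_take.
rewrite Efs /column /Ykey (nth_map 0); last by rewrite size_iota; lia.
by rewrite nth_iota; [rewrite add1n prednK //|]; lia.
Qed.
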